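(* Let $n\ge 1$, $1\le p<\infty$, and let $K\subset\mathbb R^n$ be an origin-symmetric convex body. There exists a constant $C=C(n)>0$ depending only on $n$ such that for all $f\in C_c^\infty(\mathbb R^n)$, $$\frac{2}{n}\int_{\mathbb R^n}\|\nabla f(x)\|_{Z_p^*K}^p\,dx\;\le\;\left[\frac{f(x)-f(y)}{\|x-y\|_K^{\frac np+1}}\right]^p_{M^p(\mathbb R^n\times\mathbb R^n,\mathcal L^{2n})}\;\le\; C\int_{\mathbb R^n}\|\nabla f(x)\|_{Z_p^*K}^p\,dx .$$ Moreover, setting for $\lambda>0$ $$E_{\lambda,K}=\left\{(x,y)\in\mathbb R^n\times\mathbb R^n:\ x\neq y,\ \frac{|f(x)-f(y)|}{\|x-y\|_K^{\frac{n}{p}+1}}\geq\lambda\right\},$$ one has $$\lim_{\lambda\to\infty}\lambda^p\,\mathcal L^{2n}(E_{\lambda,K})=\frac{2}{n}\int_{\mathbb R^n}\|\nabla f(x)\|_{Z_p^*K}^p\,dx.$$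
   Context: A convex body is a compact convex subset of $\mathbb R^n$ with non-empty interior; origin-symmetric means $K=-K$. The Minkowski functional is $\|x\|_K=\inf\{\lambda\ge 0: x\in\lambda K\}$, a norm on $\mathbb R^n$. The polar $L^p$ moment body $Z_p^*K$ is defined through its norm $\|z\|_{Z_p^*K}^p=\frac{n+p}{2}\int_K|z\cdot y|^p\,dy$ for $z\in\mathbb R^n$. $\mathcal L^{2n}$ is Lebesgue measure on $\mathbb R^n\times\mathbb R^n$. For a measurable function $g$ on $\mathbb R^n\times\mathbb R^n$ (defined a.e., here off the diagonal $x=y$), the weak $L^p$ (Marcinkiewicz) quasinorm is $[g]^p_{M^p(\mathbb R^n\times\mathbb R^n,\mathcal L^{2n})}=\sup_{\lambda>0}\lambda^p\,\mathcal L^{2n}(\{(x,y): |g(x,y)|\ge\lambda\})$. *)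

(* Defs.v *)
From HB Require Import structures.
From mathcomp Require Import all_boot all_order all_algebra.
From mathcomp Require Import all_classical all_reals all_analysis.
Set Implicit Arguments. Unset Strict Implicit. Unset Printing Implicit Defensive.
Import Order.TTheory GRing.Theory Num.Theory.
Import numFieldNormedType.Exports.
Local Open Scope classical_set_scope.
Local Open Scope ring_scope.

Section Defs.
Variable R : realType.

Definition dotp n (z y : 'rV[R]_n) : R := \sum_(i < n) z ord0 i * y ord0 i.

(* iterated Lebesgue integral over R^n of a [0,+oo]-valued function *)
Fixpoint iint (n : nat) : ('rV[R]_n -> \bar R) -> \bar R :=
  match n return ('rV[R]_n -> \bar R) -> \bar R with
  | 0 => fun g => g 0
  | n'.+1 => fun g =>
      (\int[@lebesgue_measure R]_(x in setT) iint (fun v : 'rV[R]_n' => g (row_mx (x%:M : 'rV[R]_1) v)))%E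
  end.

Definition leb2n n (E : set ('rV[R]_n * 'rV[R]_n)) : \bar R :=
  iint (fun x => iint (fun y => (\1_E (x, y))%:E)).

Definition convex_body n (K : set 'rV[R]_n) : Prop :=
  compact K /\ (exists x, interior K x) /\
  (forall x y (t : R), K x -> K y -> 0 <= t <= 1 -> K (t *: x + (1 - t) *: y)).

Definition origin_symmetric n (K : set 'rV[R]_n) : Prop := forall x, K x <-> K (- x).

Definition minkowski_functional n (K : set 'rV[R]_n) (x : 'rV[R]_n) : R :=
  inf [set l : R | 0 <= l /\ exists2 y, K y & x = l *: y].

Definition normZpK n (p : R) (K : set 'rV[R]_n) (z : 'rV[R]_n) : R :=
  (((n%:R + p) / 2) * fine (iint (fun y => (\1_K y * `|dotp z y| `^ p)%:E))) `^ p^-1.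

Definition gradient n (f : 'rV[R]_n -> R) (x : 'rV[R]_n) : 'rV[R]_n :=
  \row_(i < n) ('D_(delta_mx ord0 i) f) x.

Fixpoint smooth_k n (k : nat) (f : 'rV[R]_n -> R) : Prop :=
  match k with
  | 0 => continuous f
  | k'.+1 => continuous f /\ (forall a v, derivable f a v) /\
             (forall v, smooth_k k' ('D_v f))
  end.

Definition smooth_compact_support n (f : 'rV[R]_n -> R) : Prop :=
  (forall k, smooth_k k f) /\ compact (closure [set x | f x != 0]).

Definition weakLp_pow n (p : R) (D : set ('rV[R]_n * 'rV[R]_n))
  (g : 'rV[R]_n -> 'rV[R]_n -> R) : \bar R :=
  ereal_sup [set ((lam `^ p)%:E * leb2n [set xy | D xy /\ (lam <= `|g xy.1 xy.2|)%R])%E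
            | lam in [set lam : R | 0 < lam]].

End Defs.

(* Main.v *)
(** Put [y = x + h].  Rescaling [h = e k] with [e = lam^(-p/n)] turns
    [lam^p |E_lam|] into the measure of the pairs [(x, k)] such that
    [|f (x + e k) - f x| / e >= ||k||^(n/p+1)].  As [lam] grows these sets stay in a
    fixed bounded set and converge, off a null set, to
    [{ |grad f(x) . k| >= ||k||^(n/p+1) }], so dominated convergence yields the limit.
    Its value comes from the polar formula
    [\int F = a \int_K ||m||^a \int_0^oo s^(n-1) F(s m) ds dm], proved without polar
    coordinates by inserting [1 = a ||h||^a \int_(||h||)^oo s^(-a-1) ds] and scaling
    [h = s m].  The lower bound follows from the limit.
    For the upper bound, the polar formula with [a = n + p] reduces [|E_lam|] to lines
    in the directions [m] of [K]; averaging over the translates [x + t m], it remains to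
    bound, for a function [phi] of one variable, the weighted measure of the pairs
    [(t, s)] with [|phi (t + s) - phi t| >= c s^(n/p+1)].  By Young's inequality each
    such interval satisfies [c^p s^(n+1) <= \int_t^(t+s) |phi'|^p], and a Vitali
    covering argument sums these estimates with a constant depending only on [n]. *)

Require Import Defs.
From HB Require Import structures.
From mathcomp Require Import all_boot all_order all_algebra.
From mathcomp Require Import all_classical all_reals all_analysis.
From mathcomp Require Import measurable_realfun ring lra.
Set Implicit Arguments.
Unset Strict Implicit.
Unset Printing Implicit Defensive.
Import Order.TTheory GRing.Theory Num.Theory.
Import numFieldNormedType.Exports.
Local Open Scope classical_set_scope.
Local Open Scope ring_scope.

(** * Lebesgue measure on row vectors *)

(** The volume in the statement is an iterated integral, while the argument needs Tonelli and
    dominated convergence. A sigma-finite measure on row vectors is therefore built first, by the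
    recursion of [iint]. The exponent [a = n + p] in the polar formula is forced by
    [(n/p + 1) p = n + p]: by homogeneity the estimate in the direction [m] carries the factor
    [||m||^(-(n+p))], which the weight of the formula cancels. After that [K] is only the domain of
    integration, and the prefactor [n + p] is the one in the normalisation of the [Z_p^*K] norm.
    This is why [C] depends neither on [K] nor on [p]. The same cancellation gives the value of the
    limit. Pointwise convergence can fail only where equality holds in the limiting inequality. Each
    ray from the origin carries at most one such point, so the polar formula also shows that these
    points are negligible. [smooth_k] provides directional derivatives only, so the linearity of the
    derivative in its direction has to be proved. *)

Lemma measurable_set_bool d (T : measurableType d) (b : T -> bool) :
  measurable_fun setT b -> measurable [set x | b x].
Proof.
move=> mb; rewrite -[X in measurable X]setTI.
have -> : [set x | b x] = b @^-1` [set true] by [].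
exact: mb.
Qed.

(** A display is a mere label; an opaque one keeps this sigma-algebra apart from all others. *)
Definition rV_display : measure_display. Proof. exact. Qed.

Section rV_measurable.
Context {R : realType} (n : nat).
Let coord (i : 'I_n) (v : 'rV[R]_n) : measurableTypeR R := v ord0 i.
Let rV_set0 : g_sigma_preimage coord set0.
Proof. exact: sigma_algebra0. Qed.
Let rV_setC A : g_sigma_preimage coord A -> g_sigma_preimage coord (~` A).
Proof. exact: sigma_algebraC. Qed.
Let rV_bigcup (F : _^nat) : (forall i, g_sigma_preimage coord (F i)) ->
  g_sigma_preimage coord (\bigcup_i (F i)).
Proof. exact: sigma_algebra_bigcup. Qed.
(** Generated by the coordinates, so that measurability into row vectors is checked coordinatewise;
    [open_measurable_rV] relates it to the topology. *)
HB.instance Definition _ := @isMeasurable.Build rV_display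
  'rV[R]_n (g_sigma_preimage coord) rV_set0 rV_setC rV_bigcup.
End rV_measurable.

Lemma measurable_coord {R : realType} (n : nat) (i : 'I_n) :
  measurable_fun [set: 'rV[R]_n] (fun v : 'rV[R]_n => v ord0 i).
Proof.
move=> _ Y mY; rewrite setTI; apply: sub_sigma_algebra => /=.
rewrite -bigcup_seq/=; exists i => /=; first by rewrite mem_index_enum.
by exists Y => //; rewrite setTI.
Qed.

Lemma measurable_fun_rV {R : realType} (n : nat) d (T : measurableType d) (f : T -> 'rV[R]_n) :
  (forall i, measurable_fun setT (fun x => f x ord0 i)) -> measurable_fun setT f.
Proof.
move=> mf.
have h : g_sigma_preimage (fun i => (fun v : 'rV[R]_n => v ord0 i : measurableTypeR R) \o f) `<=` measurable.
  apply: smallest_sub; first exact: sigma_algebra_measurable.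
  case: n => [|m] in f mf *; first by rewrite big_ord0.
  rewrite -bigcup_mkord_ord; apply: bigcup_sub => i Ii.
  by move=> A [B mB <-]; exact: mf.
rewrite g_sigma_preimage_comp in h.
by move=> _ A mA; apply: h; exists A.
Qed.

(** Each point of [U] lies in a cube with rational centre and radius inside [U]. There are countably
    many such cubes, each a finite intersection of coordinate strips. A radius below [e / 2]
    suffices, since two points of the cube differ by less than twice the radius in each
    coordinate. *)
Lemma open_measurable_rV {R : realType} (n : nat) (U : set 'rV[R]_n) : open U -> measurable U.
Proof.
move=> oU.
pose q (c : 'rV[rat]_n) : 'rV[R]_n := map_mx ratr c.
pose B (cr : 'rV[rat]_n * rat) : set 'rV[R]_n :=
  [set v | forall i, `|v ord0 i - q cr.1 ord0 i| < ratr cr.2].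
have mB cr : measurable (B cr).
  rewrite (_ : B cr = \big[setI/setT]_(i < n)
     [set v : 'rV[R]_n | `|v ord0 i - q cr.1 ord0 i| < ratr cr.2]).
    apply: bigsetI_measurable => i _.
    rewrite -[X in measurable X]setTI.
    have := @measurable_fun_ltr _ _ R setT
      (fun v : 'rV[R]_n => `|v ord0 i - q cr.1 ord0 i|) (cst (ratr cr.2)).
    move=> /(_ _ _ measurableT [set true]); apply => //.
    apply: measurableT_comp => //; apply: measurable_funB => //.
    exact: measurable_coord.
  by rewrite -bigcap_seq; apply/seteqP; split => [v Bv i _ | v Bv i];
    [exact: Bv|apply: Bv => /=; rewrite mem_index_enum].
have -> : U = \bigcup_(cr in [set cr | B cr `<=` U]) B cr.
  apply/seteqP; split => [v Uv|v [cr /= + Bv]]; last exact.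
  have /nbhs_ballP[e /= e0 eU] : nbhs v U by exact: open_nbhs_nbhs.
  have [r /andP[r0 re]] : exists r : rat, (0 : R) < ratr r < e / 2.
    have [r] := @rat_in_itvoo R 0 (e / 2) (divr_gt0 e0 (ltr0Sn _ 1)).
    by rewrite in_itv/= => h; exists r.
  have Hc (i : 'I_n) : exists c : rat, `|v ord0 i - ratr c| < ratr r.
    have [|c] := @rat_in_itvoo R (v ord0 i - ratr r) (v ord0 i + ratr r).
      by rewrite ltrD2l gtrN.
    rewrite in_itv/= => /andP[h1 h2]; exists c.
    by rewrite ltr_norml; lra.
  have [c Pc] := choice Hc.
  pose cc : 'rV[rat]_n := \row_i c i.
  exists (cc, r) => /=; last by move=> i; rewrite !mxE.
  move=> w /= Bw; apply: eU.
  split=> // i j.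
  rewrite (ord1 i) /ball/= (_ : v ord0 j - w ord0 j = (v ord0 j - q cc ord0 j) - (w ord0 j - q cc ord0 j)); last first.
    by ring.
  rewrite (le_lt_trans (ler_normB _ _))// (splitr e) ltrD//.
    by rewrite (lt_trans _ re)// !mxE.
  by rewrite (lt_trans _ re)//; exact: Bw.
rewrite bigcup_mkcond; apply: countable_bigcupT_measurable => [|cr].
  exact: countableP.
by case: ifPn.
Qed.

Lemma continuous_measurable_rV {R : realType} (n : nat) (f : 'rV[R]_n -> R) :
  continuous f -> measurable_fun setT f.
Proof.
move=> /continuousP cf; apply: (measurability _ (RGenOpens.measurableE R)).
move=> _ [_ [a [b ->] <-]]; rewrite setTI.
apply: open_measurable_rV; apply: cf; exact: interval_open.
Qed.

Lemma measurable_row_mx {R : realType} n d (T : measurableType d)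
    (f : T -> R) (g : T -> 'rV[R]_n) :
  measurable_fun setT f -> measurable_fun setT g ->
  measurable_fun setT (fun t => row_mx (f t)%:M (g t) : 'rV[R]_n.+1).
Proof.
move=> mf mg; apply: measurable_fun_rV => i.
case: (@split_ordP 1 n i) => j ->.
  rewrite [X in measurable_fun _ X](_ : _ = f)//.
  apply/funext => t; rewrite [LHS](row_mxEl (f t)%:M (g t) ord0 j).
  by rewrite mxE (ord1 j) eqxx mulr1n.
rewrite [X in measurable_fun _ X](_ : _ = fun t => g t ord0 j).
  exact: (measurableT_comp (measurable_coord j) mg).
by apply/funext => t; rewrite [LHS](row_mxEr (f t)%:M (g t) ord0 j).
Qed.

(** The gluing in the recursive step of [iint], as a map on the product along which a product
    measure can be pushed forward. *)
Definition rV_cons {R : realType} n (p : measurableTypeR R * 'rV[R]_n) : 'rV[R]_n.+1 :=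
  row_mx (p.1%:M : 'rV[R]_1) p.2.

Lemma rV_cons_ord0 {R : realType} n (p : R * 'rV[R]_n) :
  rV_cons p ord0 ord0 = p.1.
Proof.
have -> : ord0 = @lshift 1 n ord0 by exact/val_inj.
by rewrite [LHS](row_mxEl _ _ ord0 ord0) mxE mulr1n.
Qed.

Lemma rV_cons_lift {R : realType} n (p : R * 'rV[R]_n) j :
  rV_cons p ord0 (lift ord0 j) = p.2 ord0 j.
Proof.
have -> : lift ord0 j = @rshift 1 n j by exact/val_inj.
by rewrite [LHS](row_mxEr _ _ ord0 j).
Qed.

Lemma measurable_rV_cons {R : realType} n : measurable_fun setT (@rV_cons R n).
Proof. exact: measurable_row_mx. Qed.

Lemma measurable_rsubmx {R : realType} n :
  measurable_fun setT (fun v : 'rV[R]_n.+1 => @rsubmx R 1 1 n v).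
Proof.
apply: measurable_fun_rV => i.
under eq_fun do rewrite mxE.
exact: measurable_coord.
Qed.

Section rV_measure_step.
Context {R : realType} (n : nat) (m : {sigma_finite_measure set 'rV[R]_n -> \bar R}).
Local Open Scope ereal_scope.

Definition rV_measure_step : set 'rV[R]_n.+1 -> \bar R :=
  pushforward (@lebesgue_measure R \x m) (@rV_cons R n).

Let mpre A : measurable A -> measurable (@rV_cons R n @^-1` A).
Proof. by move=> mA; rewrite -[X in measurable X]setTI; exact: measurable_rV_cons. Qed.

Let step0 : rV_measure_step set0 = 0.
Proof. by rewrite /rV_measure_step /pushforward preimage_set0 measure0. Qed.

Let step_ge0 A : 0 <= rV_measure_step A.
Proof. by rewrite /rV_measure_step /pushforward measure_ge0. Qed.

Let step_additive : semi_sigma_additive rV_measure_step.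
Proof.
move=> F mF tF mUF; rewrite /rV_measure_step /pushforward preimage_bigcup.
apply: measure_semi_sigma_additive.
- by move=> k; exact: mpre.
- apply/trivIsetP => /= i j _ _ ij; rewrite -preimage_setI.
  by move/trivIsetP : tF => /(_ _ _ _ _ ij) ->//; rewrite preimage_set0.
- by rewrite -preimage_bigcup; exact: mpre.
Qed.

HB.instance Definition _ := isMeasure.Build _ _ _ rV_measure_step
  step0 step_ge0 step_additive.

Let step_sigma_finite : sigma_finite setT rV_measure_step.
Proof.
have /sigma_finiteP[F [FT ndF Foo]] := sigma_finiteT (@lebesgue_measure R).
have /sigma_finiteP[G [GT ndG Goo]] := sigma_finiteT m.
(* The rectangles [F k * G k] exhaust the product. Pulled back along [u] they exhaust the rows, and
   because [u] is a left inverse of [rV_cons] their measure is that of the rectangles. *)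
pose u (v : 'rV[R]_n.+1) : measurableTypeR R * 'rV[R]_n :=
  (v ord0 ord0, @rsubmx R 1 1 n v).
have uK : cancel (@rV_cons R n) u.
  move=> [x v]; rewrite /u /rV_cons/= row_mxKr; congr pair.
  exact: (rV_cons_ord0 (x, v)).
exists (fun k => u @^-1` (F k `*` G k)).
  rewrite -preimage_bigcup (_ : \bigcup_k _ = setT) ?preimage_setT//.
  rewrite -subTset => -[x y] _.
  have [i _ Fx] : (\bigcup_k F k) x by rewrite -FT.
  have [j _ Gy] : (\bigcup_k G k) y by rewrite -GT.
  exists (maxn i j) => //; split => /=.
    by move: x Fx; exact/subsetPset/ndF/leq_maxl.
  by move: y Gy; exact/subsetPset/ndG/leq_maxr.
move=> k; have [mF Fk] := Foo k; have [mG Gk] := Goo k; split.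
  rewrite -[X in measurable X]setTI; apply: measurable_fun_pair => //.
  - exact: measurable_coord.
  - exact: measurable_rsubmx.
  - exact: measurableX.
rewrite /rV_measure_step /pushforward -comp_preimage.
rewrite (_ : u \o @rV_cons R n = id); last by apply/funext => x; exact: uK.
by rewrite preimage_id product_measure1E// lte_mul_pinfty// ge0_fin_numE.
Qed.

HB.instance Definition _ := Measure_isSigmaFinite.Build _ _ _ rV_measure_step
  step_sigma_finite.

End rV_measure_step.

(** The Dirac mass at the only point of ['rV_0] matches the base case [g 0] of [iint]. *)
Fixpoint rV_measure {R : realType} n : {sigma_finite_measure set 'rV[R]_n -> \bar R} :=
  match n with
  | 0 => dirac (0 : 'rV[R]_0)
  | n'.+1 => rV_measure_step (rV_measure n')
  end.

Lemma measurable_fun_param_integral {R : realType} {d1 d2} {X : measurableType d1}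
    {Y : measurableType d2} (m : {sigma_finite_measure set Y -> \bar R})
    (F : X -> Y -> \bar R) :
  (forall x y, (0 <= F x y)%E) ->
  measurable_fun setT (fun z : X * Y => F z.1 z.2) ->
  measurable_fun setT (fun x => (\int[m]_y F x y)%E).
Proof.
move=> F0 mF.
exact: (@measurable_fun_fubini_tonelli_F _ _ _ _ _ m (fun z : X * Y => F z.1 z.2)).
Qed.

Lemma integral_rV_cons {R : realType} n (g : 'rV[R]_n.+1 -> \bar R) :
  measurable_fun setT g -> (forall x, (0 <= g x)%E) ->
  (\int[rV_measure n.+1]_v g v = \int[@lebesgue_measure R]_x
     \int[rV_measure n]_v g (rV_cons (x, v)))%E.
Proof.
move=> mg g0.
have mgc : measurable_fun setT (g \o @rV_cons R n).
  exact: (measurableT_comp mg (@measurable_rV_cons R n)).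
rewrite /= /rV_measure_step ge0_integral_pushforward//; last exact: measurable_rV_cons.
rewrite preimage_setT.
by rewrite fubini_tonelli1//; last by move=> x; exact: g0.
Qed.

Lemma iintE {R : realType} n (g : 'rV[R]_n -> \bar R) :
  measurable_fun setT g -> (forall x, (0 <= g x)%E) ->
  iint g = (\int[rV_measure n]_x g x)%E.
Proof.
elim: n g => [|n IH] g mg g0.
  by rewrite /= integral_dirac// diracT mul1e.
rewrite integral_rV_cons//=; apply: eq_integral => x _.
have mgc : measurable_fun setT (g \o @rV_cons R n).
  exact: (measurableT_comp mg (@measurable_rV_cons R n)).
rewrite (IH (fun v => g (rV_cons (x, v))))//.
exact: (measurableT_comp mgc (pair1_measurable x)).
Qed.

(** * Dilations and translations of Lebesgue measure *)

Section change_of_variables.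
Context {R : realType}.
Local Open Scope ereal_scope.
Notation mu := (@lebesgue_measure R).

(** [s] times the pushforward of [mu] under the affine map gives half-open intervals their length,
    hence is [mu] by uniqueness. *)
Lemma lebesgue_measure_affine (s a : R) (A : set R) : (0 < s)%R -> measurable A ->
  mu ((fun x => s * x + a)%R @^-1` A) = (s^-1)%:E * mu A.
Proof.
move=> s0 mA.
pose h : R -> measurableTypeR R := (fun x => s * x + a)%R.
have mh : measurable_fun setT h.
  by apply: measurable_funD => //; exact: measurable_funM.
pose nu : {measure set (measurableTypeR R) -> \bar R} :=
  mscale (NngNum (ltW s0)) (pushforward mu h).
have E : forall B, measurable B -> mu B = nu mh B.
  apply: lebesgue_measure_unique => _ [[x y] _ <-].
  rewrite /nu/= /mscale/= /pushforward.
  rewrite (_ : h @^-1` `]x, y]%classic = `](x - a) / s, (y - a) / s]%classic)%R; last first.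
    apply/seteqP; split => z /=; rewrite !in_itv/= /h.
      by rewrite ltr_pdivrMr// ler_pdivlMr// => /andP[? ?]; lra.
    by rewrite ltr_pdivrMr// ler_pdivlMr// => /andP[? ?]; lra.
  rewrite !lebesgue_measure_itv/= !lte_fin ltr_pM2r ?invr_gt0// ltrD2r.
  case: ifPn => _; last by rewrite mule0.
  by rewrite -!EFinB -EFinM; congr EFin; field; lra.
rewrite (E _ mA) /nu/= /mscale/= /pushforward/= muleA -EFinM mulVf ?mul1e//.
by rewrite gt_eqF.
Qed.

Lemma ge0_integral_affine (s a : R) (f : R -> \bar R) : (0 < s)%R ->
  measurable_fun setT f -> (forall x, 0 <= f x) ->
  \int[mu]_x f (s * x + a)%R = (s^-1)%:E * \int[mu]_x f x.
Proof.
move=> s0 mf f0.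
pose h : measurableTypeR R -> measurableTypeR R := (fun x => s * x + a)%R.
have mh : measurable_fun setT h.
  by apply: measurable_funD => //; exact: measurable_funM.
have i0 : (0 <= s^-1)%R by rewrite invr_ge0 ltW.
transitivity (\int[mu]_(x in h @^-1` setT) (f \o h) x).
  by rewrite preimage_setT.
rewrite -ge0_integral_pushforward//.
transitivity (\int[mscale (NngNum i0) mu]_x f x).
  by apply: eq_measure_integral => A mA _; exact: lebesgue_measure_affine.
by rewrite ge0_integral_mscale.
Qed.

Lemma rV_cons_linear n (s x y : R) (v w : 'rV[R]_n) :
  (s *: rV_cons (x, v) + rV_cons (y, w) = rV_cons (s * x + y, s *: v + w))%R.
Proof.
apply/rowP => i; rewrite mxE [X in (X + _)%R]mxE.
by case: (unliftP ord0 i) => [j|] ->; rewrite ?rV_cons_lift ?rV_cons_ord0 ?mxE.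
Qed.

Lemma measurable_affine_rV n (s : R) (a : 'rV[R]_n) :
  measurable_fun setT (fun x : 'rV[R]_n => s *: x + a)%R.
Proof.
apply: measurable_fun_rV => i.
under eq_fun do rewrite !mxE.
apply: measurable_funD => //; apply: measurable_funM => //.
exact: measurable_coord.
Qed.

(** Serves for translations ([s = 1]) and for dilations ([a = 0]). Each coordinate contributes one
    factor [s^-1]. *)
Lemma ge0_integral_rV_affine n (s : R) (a : 'rV[R]_n) (f : 'rV[R]_n -> \bar R) :
  (0 < s)%R -> measurable_fun setT f -> (forall x, 0 <= f x) ->
  \int[rV_measure n]_x f (s *: x + a)%R =
  (s^-1 ^+ n)%:E * \int[rV_measure n]_x f x.
Proof.
move=> s0; elim: n a f => [|n IH] a f mf f0.
  rewrite /= expr0 mul1e; apply: eq_integral => x _; congr f.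
  by apply/rowP => -[].
rewrite integral_rV_cons//; last exact: (measurableT_comp mf (measurable_affine_rV s a)).
rewrite integral_rV_cons//.
have [y [w ->]] : exists y w, a = rV_cons (y, w).
  exists (a ord0 ord0), (\row_j a ord0 (lift ord0 j)); apply/rowP => i.
  by case: (unliftP ord0 i) => [j|] ->; rewrite ?rV_cons_lift ?rV_cons_ord0 ?mxE.
have mfc : measurable_fun setT (f \o @rV_cons R n).
  exact: (measurableT_comp mf (@measurable_rV_cons R n)).
have mfx x : measurable_fun setT (fun v => f (rV_cons (x, v))).
  exact: (measurableT_comp mfc (pair1_measurable x)).
under eq_integral => x _.
  under eq_integral do rewrite rV_cons_linear.
  rewrite (IH w (fun v => f (rV_cons (s * x + y, v))%R))//.
  over.
pose G (x : R) := \int[rV_measure n]_v f (rV_cons (x, v)).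
have mG : measurable_fun setT G by exact: measurable_fun_param_integral.
have G0 x : 0 <= G x by exact: integral_ge0.
rewrite -[X in _ = _ * X]/(\int[mu]_x G x).
rewrite -[X in X = _]/(\int[mu]_x ((s^-1 ^+ n)%:E * G (s * x + y)%R)).
clearbody G; rewrite exprSr EFinM -muleA -(ge0_integral_affine y s0 mG G0).
rewrite (@ge0_integralZl _ _ _ mu _ measurableT (fun x : R => G (s * x + y)%R))//.
  by apply: (measurableT_comp mG); apply: measurable_funD => //; exact: measurable_funM.
by rewrite lee_fin exprn_ge0// invr_ge0 ltW.
Qed.

End change_of_variables.

Lemma measurable_box {R : realType} n (M : R) :
  measurable [set v : 'rV[R]_n | forall i, `|v ord0 i| <= M].
Proof.
rewrite (_ : mkset _ = \bigcap_(i in [set: 'I_n]) [set v : 'rV[R]_n | `|v ord0 i| <= M]).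
  apply: fin_bigcap_measurable => // i _.
  apply: measurable_set_bool; apply: measurable_fun_ler => //.
  by apply: measurableT_comp => //; exact: measurable_coord.
by apply/seteqP; split => v /= h i; [move=> _; exact: h|exact: h].
Qed.

Lemma rV_measure_box {R : realType} n (M : R) :
  (rV_measure n [set v : 'rV[R]_n | forall i, (`|v ord0 i| <= M)%R] < +oo)%E.
Proof.
elim: n => [|n IH]; first by rewrite /= diracE ltry.
rewrite /= /rV_measure_step /pushforward.
rewrite (_ : _ @^-1` _ = `[-M, M]%classic `*`
    [set v : 'rV[R]_n | forall i, `|v ord0 i| <= M]).
  rewrite product_measure1E//; last exact: measurable_box.
  rewrite lte_mul_pinfty//.
    by rewrite [X in X \is a _](lebesgue_measure_itv `[- M, M]%R)/=; case: ifPn.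
apply/seteqP; split => -[x v] /= h.
  split; first by have := h ord0; rewrite rV_cons_ord0/= ler_norml in_itv.
  by move=> i; have := h (lift ord0 i); rewrite rV_cons_lift.
move=> i; case: (unliftP ord0 i) => [j|] ->; rewrite ?rV_cons_lift ?rV_cons_ord0.
  exact: h.2.
by rewrite ler_norml; have := h.1; rewrite in_itv.
Qed.

Lemma measurable_rV_set0 {R : realType} n : measurable [set (0 : 'rV[R]_n)].
Proof.
rewrite (_ : [set _] = [set v : 'rV[R]_n | forall i, `|v ord0 i| <= 0]).
  exact: measurable_box.
apply/seteqP; split => v /=; first by move=> -> i; rewrite mxE normr0.
by move=> h; apply/rowP => i; apply/eqP; rewrite mxE -normr_le0 h.
Qed.

Lemma rV_measure_set0 {R : realType} n : (0 < n)%N ->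
  rV_measure n [set (0 : 'rV[R]_n)] = 0%E.
Proof.
case: n => // n _; rewrite /= /rV_measure_step /pushforward.
rewrite (_ : _ @^-1` _ = [set 0 : R] `*` [set (0 : 'rV[R]_n)]).
  rewrite product_measure1E//; last exact: measurable_rV_set0.
  by rewrite [X in (X * _)%E](lebesgue_measure_set1 0) mul0e.
apply/seteqP; split => -[x v] /= h.
  split; first by have := congr1 (fun w : 'rV__ => w ord0 ord0) h; rewrite rV_cons_ord0/= mxE.
  apply/rowP => i; have := congr1 (fun w : 'rV__ => w ord0 (lift ord0 i)) h.
  by rewrite rV_cons_lift/= !mxE.
case: h => /= -> ->; apply/rowP => i.
by case: (unliftP ord0 i) => [j|] ->; rewrite ?rV_cons_lift ?rV_cons_ord0 ?mxE.
Qed.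

(** * The polar formula *)

Section powR_integral.
Context {R : realType}.
Notation mu := (@lebesgue_measure R).

Lemma powR_cvgy (a : R) : 0 < a -> (s `^ a) @[s --> +oo] --> +oo.
Proof.
move=> a0; apply/cvgryPge => A; near=> s.
have h : Num.max A 1 `^ a^-1 <= s by near: s; apply: nbhs_pinfty_ge; rewrite num_real.
apply: (@le_trans _ _ (Num.max A 1)); first by rewrite le_max lexx.
rewrite -[leLHS]powRr1; last by rewrite le_max ler01 orbT.
rewrite -(mulVf (lt0r_neq0 a0)) powRrM.
apply: ge0_ler_powR => //; rewrite ?nnegrE ?powR_ge0 ?ltW//.
Unshelve. all: by end_near. Qed.

Lemma integral_powR_itvcy (a c : R) : 0 < a -> 0 < c ->
  (\int[mu]_(s in `[c, +oo[) (s `^ (- (a + 1)))%:E = (c `^ (- a) / a)%:E)%E.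
Proof.
move=> a0 c0.
pose F (s : R) := (- a^-1) * s `^ (- a).
have dF (x : R) : 0 < x -> is_derive x 1 F (x `^ (- (a + 1))).
  move=> x0; have D := is_derive1_powR (- a) x0.
  rewrite (_ : F = (- a^-1) \*: (fun s => s `^ (- a)))//; apply: is_derive_eq.
  by rewrite /GRing.scale/= mulrA mulrNN mulVf ?mul1r ?opprD// gt_eqF.
have cpow (b x : R) : 0 < x -> {for x, continuous (fun s : R => s `^ b)}.
  move=> x0; apply: differentiable_continuous; apply/derivable1_diffP.
  by have [] := is_derive1_powR b x0.
rewrite (@ge0_continuous_FTC2y R (fun s => s `^ (- (a + 1))) F c 0) ?sub0r.
- by rewrite sub0e -EFinN /F; congr EFin; field; rewrite gt_eqF.
- by move=> x _; exact: powR_ge0.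
- apply: continuous_in_subspaceT => x; rewrite inE/= in_itv/= andbT => cx.
  by apply: cpow; exact: lt_le_trans cx.
- rewrite -(mulr0 (- a^-1)); apply: cvgMr => //.
  rewrite (_ : (fun x => x `^ (- a)) = (fun x => (x `^ a)^-1)); last first.
    by apply/funext => x; rewrite powRN.
  apply/(gtr0_cvgV0 (f := fun x => x `^ a)); last exact: powR_cvgy.
  near=> x; apply: powR_gt0; near: x; by apply: nbhs_pinfty_gt; rewrite num_real.
- by move=> x cx; have [] := dF _ (lt_trans c0 cx).
- apply: cvg_at_right_filter; apply: cvgMr => //; exact: cpow.
- move=> x; rewrite in_itv/= andbT => cx; rewrite derive1E.
  by have [_ ->] := dF _ (lt_trans c0 cx).
Unshelve. all: by end_near. Qed.

End powR_integral.

Lemma measurable_bool_natr {R : realType} d (T : measurableType d) (b : T -> bool) :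
  measurable_fun setT b -> measurable_fun setT (fun x => (b x)%:R : R).
Proof.
move=> mb; exact: (measurableT_comp (f := fun c : bool => c%:R : R)).
Qed.

Lemma tonelli_swap {R : realType} {d1 d2} {X : measurableType d1} {Y : measurableType d2}
    (m1 : {sigma_finite_measure set X -> \bar R})
    (m2 : {sigma_finite_measure set Y -> \bar R}) (F : X -> Y -> \bar R) :
  (forall x y, (0 <= F x y)%E) ->
  measurable_fun setT (fun z : X * Y => F z.1 z.2) ->
  (\int[m1]_x \int[m2]_y F x y = \int[m2]_y \int[m1]_x F x y)%E.
Proof.
move=> F0 mF.
exact: (@fubini_tonelli _ _ _ _ _ m1 m2 (fun z : X * Y => F z.1 z.2)).
Qed.

Lemma measurable_scale_rV {R : realType} n d (T : measurableType d)
    (s : T -> R) (v : T -> 'rV[R]_n) :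
  measurable_fun setT s -> measurable_fun setT v ->
  measurable_fun setT (fun x => s x *: v x).
Proof.
move=> ms mv; apply: measurable_fun_rV => i.
under eq_fun do rewrite mxE.
apply: measurable_funM => //.
exact: (measurableT_comp (measurable_coord i) mv).
Qed.

Section polar.
Context {R : realType} (n : nat) (N : 'rV[R]_n.+1 -> R).
Hypothesis mN : measurable_fun setT N.
Hypothesis N_gt0 : forall h, h != 0 -> 0 < N h.
Hypothesis NZ : forall s h, 0 < s -> N (s *: h) = s * N h.
Notation mu := (@lebesgue_measure R).
Local Notation V := 'rV[R]_n.+1.

Let N0 : N 0 = 0.
Proof. by have := NZ 0 (ltr0Sn R 1); rewrite scaler0 => ?; lra. Qed.

Let N_ge0 h : 0 <= N h.
Proof. by have [->|h0] := eqVneq h 0; [rewrite N0|exact/ltW/N_gt0]. Qed.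

Lemma integral_polar (a : R) (F : V -> \bar R) : 0 < a ->
  measurable_fun setT F -> (forall h, (0 <= F h)%E) ->
  (\int[rV_measure n.+1]_h F h =
   a%:E * \int[rV_measure n.+1]_m (((N m <= 1)%R%:R * N m `^ a)%:E *
     \int[mu]_s (((0 < s)%R%:R * s ^+ n)%:E * F (s *: m))))%E.
Proof.
move=> a0 mF F0.
(* [a * c h s] is the density in [s] whose integral is 1. The substitution [h = s m] separates the
   variables: [s ^+ n.+1 * c (s *: m) s = w m * v s], because the condition [N (s m) <= s] becomes
   [N m <= 1]. *)
pose c (h : V) (s : R) : R :=
  ((0 < s) && (N h <= s))%:R * (s `^ (- (a + 1)) * N h `^ a).
pose w (m : V) : R := (N m <= 1)%R%:R * N m `^ a.
pose v (s : R) : R := (0 < s)%R%:R * s ^+ n.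
have w0 m : 0 <= w m by rewrite mulr_ge0// powR_ge0.
have v0 s : 0 <= v s.
  by rewrite /v; case: (ltrP 0 s) => s0; rewrite ?mul0r// mul1r exprn_ge0// ltW.
have c0 h s : 0 <= c h s by rewrite !mulr_ge0// powR_ge0.
have mw : measurable_fun setT w.
  apply: measurable_funM.
    by apply: measurable_bool_natr; exact: measurable_fun_ler.
  exact: (measurableT_comp (measurable_powR _) mN).
have mv : measurable_fun setT v.
  apply: measurable_funM; last exact: measurable_funX.
  by apply: measurable_bool_natr; exact: measurable_fun_ltr.
have mc : measurable_fun setT (fun z : V * R => c z.1 z.2).
  have mN1 : measurable_fun setT (fun z : V * R => N z.1).
    exact: (measurableT_comp mN measurable_fst).
  apply: measurable_funM.
    apply: measurable_bool_natr; apply: measurable_and.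
      exact: measurable_fun_ltr.
    exact: measurable_fun_ler.
  apply: measurable_funM.
    exact: (measurableT_comp (measurable_powR _) measurable_snd).
  exact: (measurableT_comp (measurable_powR _) mN1).
have mFZ : measurable_fun setT (fun z : V * R => F (z.2 *: z.1)).
  by apply: (measurableT_comp mF); exact: measurable_scale_rV.
transitivity (a%:E * \int[rV_measure n.+1]_h \int[mu]_s ((c h s)%:E * F h))%E.
  rewrite -ge0_integralZl_EFin//; last 3 first.
  - by move=> h _; apply: integral_ge0 => s _; rewrite mule_ge0// lee_fin.
  - apply: measurable_fun_param_integral => [h s|].
      by rewrite mule_ge0// lee_fin.
    apply: emeasurable_funM; first exact/measurable_EFinP.
    exact: (measurableT_comp mF measurable_fst).
  - exact: ltW.
  apply: ge0_ae_eq_integral => //.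
  - apply: measurable_funeM; apply: measurable_fun_param_integral => [h s|].
      by rewrite mule_ge0// lee_fin.
    apply: emeasurable_funM; first exact/measurable_EFinP.
    exact: (measurableT_comp mF measurable_fst).
  - move=> h _; apply: mule_ge0; first by rewrite lee_fin ltW.
    by apply: integral_ge0 => s _; rewrite mule_ge0// lee_fin.
  (* The inserted factor equals 1 only where [N h > 0]; the origin is discarded as a null set. *)
  exists [set 0]; split; [exact: measurable_rV_set0|exact: rV_measure_set0|].
  move=> h /= hF; apply: contrapT => /eqP h0; apply: hF => _.
  rewrite ge0_integralZr//; last 2 first.
  - by apply/measurable_EFinP; exact: (measurableT_comp mc (pair1_measurable h)).
  - by move=> s _; rewrite lee_fin.
  rewrite muleA (_ : (a%:E * _)%E = 1%E) ?mul1e//.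
  rewrite (_ : (\int[mu]_s (c h s)%:E = (a^-1)%:E)%E); last first.
    pose q (s : R) := N h `^ a * s `^ (- (a + 1)).
    transitivity (\int[mu]_s ((EFin \o q) \_ `[N h, +oo[) s)%E.
      apply: eq_integral => s _; rewrite patchE /c /q /=.
      rewrite mem_setE in_itv/= andbT; case: ifPn => Ns.
        by rewrite (lt_le_trans (N_gt0 h0) Ns) mul1r mulrC.
      by rewrite andbF mul0r.
    rewrite -integral_mkcond/= /q.
    under eq_integral do rewrite EFinM.
    rewrite ge0_integralZl_EFin ?powR_ge0//; last first.
      by apply/measurable_EFinP/measurable_funTS.
    - by move=> s _; rewrite lee_fin powR_ge0.
    rewrite [X in (_ * X)%E](integral_powR_itvcy a0 (N_gt0 h0)) -EFinM powRN mulrA mulfV ?mul1r//.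
    by rewrite gt_eqF// powR_gt0// N_gt0.
  by rewrite -EFinM mulfV// gt_eqF.
congr (_ * _)%E.
rewrite [LHS]tonelli_swap; last 2 first.
- by move=> h s; rewrite mule_ge0// lee_fin.
- apply: emeasurable_funM; first exact/measurable_EFinP.
  exact: (measurableT_comp mF measurable_fst).
transitivity (\int[rV_measure n.+1]_m \int[mu]_s ((w m)%:E * ((v s)%:E * F (s *: m))))%E; last first.
  apply: eq_integral => m _; rewrite ge0_integralZl_EFin//.
  - by move=> s _; rewrite mule_ge0// lee_fin.
  - apply: emeasurable_funM; first exact/measurable_EFinP.
    exact: (measurableT_comp mFZ (pair1_measurable m)).
rewrite [RHS]tonelli_swap; last 2 first.
- by move=> h s; rewrite !mule_ge0// lee_fin.
- apply: emeasurable_funM.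
    by apply/measurable_EFinP; exact: (measurableT_comp mw measurable_fst).
  apply: emeasurable_funM => //.
  by apply/measurable_EFinP; exact: (measurableT_comp mv measurable_snd).
apply: eq_integral => s _.
have [s0|s0] := lerP s 0.
  rewrite !integral0_eq//.
    by move=> h _; rewrite /v ltNge s0/= mul0r mul0e mule0.
  by move=> h _; rewrite /c ltNge s0/= mul0r mul0e.
have mG : measurable_fun setT (fun h => (c h s)%:E * F h)%E.
  apply: emeasurable_funM => //.
  by apply/measurable_EFinP; exact: (measurableT_comp mc (pair2_measurable s)).
have := ge0_integral_rV_affine 0 s0 mG.
move=> /(_ (fun h => mule_ge0 (c0 h s : (0 <= (c h s)%:E)%E) (F0 h))) /(congr1 (fun x => (s ^+ n.+1)%:E * x)%E).
rewrite muleA -EFinM exprVn mulfV ?mul1e; last by rewrite expf_neq0// gt_eqF.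
move=> <-; rewrite -ge0_integralZl_EFin//; last 3 first.
- by move=> h _; rewrite mule_ge0// lee_fin.
- exact: (measurableT_comp mG (measurable_affine_rV _ _)).
- by rewrite exprn_ge0// ltW.
apply: eq_integral => h _; rewrite addr0 !muleA -!EFinM; congr (_%:E * _)%E.
rewrite /c /w /v s0 NZ//= -[X in _ <= X]mulr1 ler_pM2l// mul1r.
rewrite (powRM _ (ltW s0) (N_ge0 h)) powRN powRD; last by rewrite (gt_eqF s0) implybT.
rewrite (powRr1 (ltW s0)) exprS; case: (N h <= 1); rewrite ?mul0r ?mulr0 ?mul1r//.
by field; rewrite (gt_eqF s0) gt_eqF// powR_gt0.
Qed.
End polar.

(** * The one-dimensional estimate *)

(** Young's inequality for the exponents [p] and [p / (p - 1)]. For [p = 1] the second exponent is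
    infinite, but the claim is then an equality. *)
Lemma young_powR {R : realType} (p a c : R) : 1 <= p -> 0 <= a -> 0 <= c ->
  a * c `^ (p - 1) <= p^-1 * a `^ p + (1 - p^-1) * c `^ p.
Proof.
rewrite le_eqVlt => /predU1P[<-|p1] a0 c0.
  by rewrite invr1 !subrr powRr0 mul0r powRr1// mulr1 mul1r addr0.
have p0 : 0 < p by lra.
have q0 : 0 < p / (p - 1) by rewrite divr_gt0//; lra.
have := @conjugate_powR R a (c `^ (p - 1)) p (p / (p - 1)) a0 (powR_ge0 _ _) p0 q0.
rewrite -powRrM (_ : (p - 1) * (p / (p - 1)) = p); last by field; lra.
rewrite (_ : (p / (p - 1))^-1 = 1 - p^-1); last by field; lra.
by rewrite mulrC addrC subrK => /(_ erefl); rewrite [X in _ <= X + _]mulrC [X in _ <= _ + X]mulrC mulrC.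
Qed.

Section one_dim.
Context {R : realType} (phi dphi : R -> R).
Hypothesis dphiP : forall x : R, is_derive x 1 phi (dphi x).
Hypothesis cdphi : continuous dphi.
Notation mu := (@lebesgue_measure R).

Lemma continuous_prim : continuous phi.
Proof.
by move=> x; apply: differentiable_continuous; apply/derivable1_diffP; case: (dphiP x).
Qed.

Lemma increment_le_integral (a b : R) : a < b ->
  (`|phi b - phi a|%:E <= \int[mu]_(x in `[a, b]) `|dphi x|%:E)%E.
Proof.
move=> ab.
have F : (\int[mu]_(x in `[a, b]) (dphi x)%:E = (phi b)%:E - (phi a)%:E)%E.
  apply: continuous_FTC2 => //.
  - exact: continuous_subspaceT.
  - split=> [x _||]; first by case: (dphiP x).
    + exact/cvg_at_right_filter/continuous_prim.
    + exact/cvg_at_left_filter/continuous_prim.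
  - by move=> x _; rewrite derive1E; case: (dphiP x).
rewrite -[leLHS]/(`|(phi b)%:E - (phi a)%:E|)%E -F.
apply: le_abse_integral => //.
by apply/measurable_EFinP; apply: measurable_funTS; exact: continuous_measurable_fun.
Qed.

(** Integrating Young's inequality with the constant [c] bounds [c^(p-1) * \int |dphi|] by [p^-1 *
    \int |dphi|^p + (1 - p^-1) c^p (b - a)]. The left side is at least [c^p (b - a)], and
    subtracting leaves [p^-1] times the claim. *)
Lemma increment_powR (p c a b : R) : 1 <= p -> 0 < c -> a < b ->
  c * (b - a) <= `|phi b - phi a| ->
  ((c `^ p * (b - a))%:E <= \int[mu]_(x in `]a, b[) (`|dphi x| `^ p)%:E)%E.
Proof.
move=> p1 c0 ab h.
have mnd (D : set R) : measurable D -> measurable_fun D (fun x => `|dphi x|).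
  move=> mD; apply: measurable_funTS; apply: measurableT_comp => //.
  exact: continuous_measurable_fun.
have mpd (D : set R) : measurable D -> measurable_fun D (fun x => `|dphi x| `^ p).
  move=> mD; apply: (measurableT_comp (measurable_powR _)); exact: mnd.
rewrite integral_itv_obnd_cbnd ?integral_itv_bndo_bndc; last 2 first.
- by apply/measurable_EFinP; exact: mpd.
- by apply/measurable_EFinP; exact: mpd.
have : (\int[mu]_(x in `[a, b]) (`|dphi x| * c `^ (p - 1))%:E <=
    \int[mu]_(x in `[a, b]) (p^-1 * `|dphi x| `^ p + (1 - p^-1) * c `^ p)%:E)%E.
  apply: ge0_le_integral => //.
  - by move=> x _; rewrite lee_fin mulr_ge0// powR_ge0.
  - apply/measurable_EFinP; apply: measurable_funM => //; exact: mnd.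
  - apply/measurable_EFinP; apply: measurable_funD => //.
    by apply: measurable_funM => //; exact: mpd.
  - by move=> x _; rewrite lee_fin; apply: young_powR => //; exact: ltW.
under eq_integral do rewrite EFinM.
rewrite ge0_integralZr//; last 2 first.
- by apply/measurable_EFinP; exact: mnd.
- by rewrite lee_fin powR_ge0.
under [leRHS]eq_integral do rewrite EFinD EFinM.
have p0 : 0 < p^-1 by rewrite invr_gt0; lra.
have p1' : p^-1 <= 1 by rewrite invf_le1; lra.
rewrite ge0_integralD//; last 3 first.
- by move=> x _; rewrite -EFinM lee_fin mulr_ge0 ?powR_ge0 ?(ltW p0).
- by apply: measurable_funeM; apply/measurable_EFinP; exact: mpd.
- by move=> x _; rewrite lee_fin mulr_ge0 ?powR_ge0// subr_ge0.
rewrite ge0_integralZl_EFin//; last 2 first.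
- by apply/measurable_EFinP; exact: mpd.
- exact: ltW.
rewrite integral_cst//= lebesgue_measure_itv/= lte_fin ab.
have h1 : ((c * (b - a))%:E <= \int[mu]_(x in `[a, b]) `|dphi x|%:E)%E.
  by apply: le_trans (increment_le_integral ab); rewrite lee_fin.
have c1 : (0 <= (c `^ (p - 1))%:E)%E by rewrite lee_fin powR_ge0.
move=> /(le_trans (lee_wpmul2r c1 h1)).
set X := (\int[mu]_(x in _) _)%E.
have : (0 <= X)%E by apply: integral_ge0 => x _; rewrite lee_fin powR_ge0.
clearbody X; case: X => [x| |]//; last by move=> _ _; rewrite leey.
rewrite -!EFinM -!EFinD !lee_fin => x0.
have -> : c * (b - a) * c `^ (p - 1) = c `^ p * (b - a).
  by rewrite mulrAC mulr_powRB1//; lra.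
move=> h3.
have : p^-1 * (c `^ p * (b - a)) <= p^-1 * x by nra.
by rewrite ler_pM2l.
Qed.

End one_dim.

(* The countable Vitali subfamily is enumerated by [nat]; indices that enumerate
   nothing are sent to [(0, 0)], an interval of length 0. *)
Lemma vitali_intervals {R : realType} (V : set (R * R)) (r : R) :
  (forall i, V i -> 0 < i.2 <= r) ->
  exists q : nat -> R * R, [/\ forall k, (q k).2 = 0 \/ V (q k),
    trivIset setT (fun k => `](q k).1, (q k).1 + (q k).2[%classic) &
    forall i, V i -> exists k, i.2 <= 2 * (q k).2 /\
      `|i.1 - ((q k).1 + (q k).2 / 2)| <= 5 / 2 * (q k).2].
Proof.
move=> Vr.
(* The covering lemma wants a ball of positive radius for every index, so pairs without positive
   length get radius 1. For [i] in [V] the ball is the open interval from [i.1] to [i.1 + i.2]. *)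
pose rad (i : R * R) : R := if 0 < i.2 then i.2 / 2 else 1.
pose B (i : R * R) : set R := ball (i.1 + i.2 / 2) (rad i).
have rad0 i : 0 < rad i.
  by rewrite /rad; case: ifPn => // h; rewrite divr_gt0.
have radV i : V i -> rad i = i.2 / 2 by move=> /Vr/andP[h _]; rewrite /rad h.
have radB i : (radius (B i))%:num = rad i by rewrite radius_ball_num// ltW.
have B0 i : 0 < (radius (B i))%:num by rewrite radB.
have BV i : V i -> (radius (B i))%:num <= r.
  by move=> Vi; have := Vr i Vi; rewrite radB radV// => ?; lra.
have Bball i : is_ball (B i) by exact: is_ball_ball.
have [D [cD DV tD Dcov]] := vitali_lemma_infinite Bball B0 BV.
have [e einj] : exists e : R * R -> nat, {in D &, injective e}.
  have /countable_injP[e einj] := cD.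
  by exists e.
pose q k := if pselect (exists2 j, D j & e j = k) is left h then projT1 (cid2 h) else (0, 0).
have qP k : (q k = (0, 0)) \/ (D (q k) /\ e (q k) = k).
  rewrite /q; case: pselect => [h|]; last by left.
  by right; case: cid2.
have qD j : D j -> q (e j) = j.
  move=> Dj; rewrite /q; case: pselect => [h|[]]; last by exists j.
  case: cid2 => /= j' Dj' jj'; apply: einj; rewrite ?inE//.
exists q; split.
- by move=> k; case: (qP k) => [->|[/DV]]; [left|right].
- apply/trivIsetP => k l _ _ kl.
  case: (qP k) => [->|[Dk ek]]; first by rewrite /= addr0 set_itv_ge ?set0I// bnd_simp/= ltxx.
  case: (qP l) => [->|[Dl el]]; first by rewrite /= addr0 [X in _ `&` X]set_itv_ge ?setI0// bnd_simp/= ltxx.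
  have : q k != q l.
    by apply/eqP => qkl; move/eqP: kl; apply; rewrite -ek qkl.
  move/trivIsetP: tD => /(_ _ _ Dk Dl) /[apply] /= H.
  apply/seteqP; split => // x [xk xl]; rewrite -H.
  have sub i : V i -> `]i.1, i.1 + i.2[%classic x -> closure (B i) x.
    move=> Vi /=; rewrite in_itv/= => /andP[h1 h2]; apply: subset_closure.
    by rewrite /B /ball/= radV// ltr_norml; apply/andP; split; lra.
  by split; apply: sub => //; exact: DV.
- move=> i Vi; have [j [Dj _ hr hc]] := Dcov i Vi; exists (e j); rewrite qD//.
  have Vj := DV _ Dj; have := Vr _ Vi; have := Vr _ Vj => /andP[j0 jr] /andP[i0 ir].
  have {}hr : i.2 / 2 / 2 <= j.2 / 2.
    have : rad i / 2 <= rad j by rewrite -(radB i) -(radB j); exact: hr.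
    by rewrite (radV i Vi) (radV j Vj).
  split; first by clear - hr; lra.
  (* The covering is used at the left endpoint only: it falls in the fivefold ball around [j], whose
     radius is [5 / 2 * j.2]. *)
  have : closure (B i) i.1.
    rewrite is_ball_closure// cpoint_ball// radB closed_ballE//= /closed_ball_/=.
    by rewrite radV// ler_norml; apply/andP; split; lra.
  move=> /hc /(is_ball_closureP (is_scale_ball _ (Bball j))).
  rewrite cpoint_scale_ball// radius_scale_ball// cpoint_ball// radB radV// distrC => /le_trans; apply.
  by lra.
Qed.

Lemma integral_itv_natr {R : realType} (x y : R) (l r : bool) : x <= y ->
  (\int[@lebesgue_measure R]_t ((t \in Interval (BSide l x) (BSide r y))%:R)%:E
   = (y - x)%:E)%E.
Proof.
move=> xy; pose I := Interval (BSide l x) (BSide r y).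
transitivity (\int[@lebesgue_measure R]_t (\1_[set` I] t)%:E)%E.
  by apply: eq_integral => t _; rewrite indicE mem_setE.
rewrite integral_indic// setIT [LHS](lebesgue_measure_itv I)/= lte_fin.
by case: ltP => // yx; congr EFin; lra.
Qed.

Section one_dim_estimate.
Context {R : realType} (n : nat) (phi dphi : R -> R).
Hypothesis dphiP : forall x : R, is_derive x 1 phi (dphi x).
Hypothesis cdphi : continuous dphi.
Notation mu := (@lebesgue_measure R).

(** Regard each pair [(t, s)] of the set as the interval from [t] to [t + s] and select a Vitali
    subfamily [q]. Then the pair lies in some box where [t] is within [5/2 * (q k).2] of the
    midpoint of the selected interval and [s <= 2 * (q k).2]. The weighted integral over this box is
    [5 * 2^(n+1) * (q k).2^(n+2)], a power that [increment_powR] controls by the integral over the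
    selected interval. Disjointness lets these integrals be added. *)
Lemma one_dim_estimate (p c S : R) : 1 <= p -> 0 < c -> 0 < S ->
  (\int[mu]_t \int[mu]_s
     ([&& 0 <= t, t <= S, 0 < s, s <= S &
        c * s `^ (n.+1%:R / p + 1) <= `|phi (t + s) - phi t| ]%R%:R * s ^+ n)%:E
   <= (5 * 2 ^+ n.+1 * c `^ (- p))%:E *
      \int[mu]_(t in `[0%R, (2 * S)%R]) (`|dphi t| `^ p)%:E)%E.
Proof.
move=> p1 c0 S0.
have p0 : 0 < p by lra.
pose b (t s : R) := [&& 0 <= t, t <= S, 0 < s, s <= S &
        c * s `^ (n.+1%:R / p + 1) <= `|phi (t + s) - phi t| ].
pose V : set (R * R) := [set z | b z.1 z.2].
have VS i : V i -> 0 < i.2 <= S by move=> /and5P[_ _ -> ->].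
have [q [qV qtriv qcov]] := vitali_intervals VS.
(* [G k] and [H k] are the two sides of the [k]-th box; [H k] also bounds the weight [s ^+ n] by its
   largest value there. *)
pose G k (t : R) : R := (`|t - ((q k).1 + (q k).2 / 2)| <= 5 / 2 * (q k).2)%R%:R.
pose H k (s : R) : R := ((0 < s) && (s <= 2 * (q k).2))%R%:R * (2 * (q k).2) ^+ n.
have q0 k : 0 <= (q k).2.
  by case: (qV k) => [->//|/VS/andP[/ltW]].
have G0 k t : 0 <= G k t by exact: ler0n.
have H0 k s : 0 <= H k s by rewrite mulr_ge0// exprn_ge0// mulr_ge0.
have mG k : measurable_fun setT (G k).
  apply: measurable_bool_natr; apply: measurable_fun_ler => //.
  by apply: measurableT_comp => //; exact: measurable_funB.
have mH k : measurable_fun setT (H k).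
  apply: measurable_funM => //; apply: measurable_bool_natr; apply: measurable_and.
    exact: measurable_fun_ltr.
  exact: measurable_fun_ler.
have iG k : (\int[mu]_t (G k t)%:E = (5 * (q k).2)%:E)%E.
  set m := (q k).1 + (q k).2 / 2; set d := 5 / 2 * (q k).2.
  have d0 : 0 <= d by rewrite mulr_ge0.
  transitivity (\int[mu]_t ((t \in `[m - d, m + d])%:R)%:E)%E.
    by apply: eq_integral => t _; rewrite /G ler_distl in_itv.
  by rewrite integral_itv_natr; [congr EFin; rewrite /d; lra|lra].
have iH k : (\int[mu]_s (H k s)%:E = ((2 * (q k).2) ^+ n.+1)%:E)%E.
  under eq_integral do rewrite EFinM.
  rewrite ge0_integralZr//; last 2 first.
  - apply/measurable_EFinP; apply: measurable_bool_natr; apply: measurable_and.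
      exact: measurable_fun_ltr.
    exact: measurable_fun_ler.
  - by rewrite lee_fin exprn_ge0// mulr_ge0.
  rewrite exprS EFinM; congr (_ * _)%E.
  transitivity (\int[mu]_t ((t \in `]0, (2 * (q k).2)])%:R)%:E)%E.
    by apply: eq_integral => t _; rewrite in_itv.
  by rewrite integral_itv_natr ?subr0// mulr_ge0.
have mb : measurable_fun setT (fun z : R * R => b z.1 z.2).
  have mphi := continuous_measurable_fun (continuous_prim dphiP).
  have m1 : measurable_fun setT (fun z : R * R => z.1) by exact: measurable_fst.
  have m2 : measurable_fun setT (fun z : R * R => z.2) by exact: measurable_snd.
  apply: measurable_and; first exact: measurable_fun_ler.
  apply: measurable_and; first exact: measurable_fun_ler.
  apply: measurable_and; first exact: measurable_fun_ltr.
  apply: measurable_and; first exact: measurable_fun_ler.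
  apply: measurable_fun_ler.
    apply: measurable_funM => //; exact: (measurableT_comp (measurable_powR _) m2).
  apply: measurableT_comp => //; apply: measurable_funB.
    by apply: (measurableT_comp mphi); exact: measurable_funD.
  exact: (measurableT_comp mphi m1).
have mF : measurable_fun setT (fun z : R * R => ((b z.1 z.2)%:R * z.2 ^+ n)%:E).
  apply/measurable_EFinP; apply: measurable_funM; first exact: measurable_bool_natr.
  by apply: measurable_funX; exact: measurable_snd.
have F0 t s : (0 <= ((b t s)%:R * s ^+ n)%:E)%E.
  rewrite lee_fin; case h : (b t s); rewrite ?mul0r// mul1r exprn_ge0//.
  by move/and5P: h => [_ _ /ltW].
have GH0 k t s : (0 <= (G k t * H k s)%:E)%E by rewrite lee_fin mulr_ge0.
have mGH k : measurable_fun setT (fun z : R * R => (G k z.1 * H k z.2)%:E).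
  apply/measurable_EFinP; apply: measurable_funM.
    exact: (measurableT_comp (mG k) measurable_fst).
  exact: (measurableT_comp (mH k) measurable_snd).
have S0' t s : (0 <= \sum_(k <oo) (G k t * H k s)%:E)%E by exact: nneseries_ge0.
have mS : measurable_fun setT (fun z : R * R => (\sum_(k <oo) (G k z.1 * H k z.2)%:E)%E).
  exact: ge0_emeasurable_sum.
apply: (@le_trans _ _ (\int[mu]_t \int[mu]_s (\sum_(k <oo) (G k t * H k s)%:E)))%E.
  apply: ge0_le_integral => //.
  - by move=> t _; apply: integral_ge0 => s _; exact: F0.
  - exact: (@measurable_fun_param_integral _ _ _ _ _ mu _ F0 mF).
  - exact: (@measurable_fun_param_integral _ _ _ _ _ mu _ S0' mS).
  - move=> t _; apply: ge0_le_integral => //.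
    + by move=> s _; exact: F0.
    + exact: (measurableT_comp mF (pair1_measurable t)).
    + exact: (measurableT_comp mS (pair1_measurable t)).
    + move=> s _; case E : (b t s); rewrite -/(b t s) E; last by rewrite mul0r S0'.
      rewrite mul1r.
      have /qcov[k [/= h1 h2]] : V (t, s) by [].
      have /andP[s0 _] := VS _ (E : V (t, s)).
      apply: (@le_trans _ _ (\sum_(0 <= i < k.+1) (G i t * H i s)%:E)%E); last first.
        exact: nneseries_lim_ge.
      rewrite big_nat_recr//=; apply: le_trans (leeDr _ _); last first.
        by apply: sume_ge0 => i _; exact: GH0.
      rewrite lee_fin /G /H h2 s0 h1 !mul1r.
      by rewrite lerXn2r// nnegrE ?mulr_ge0// ltW.
have -> : (\int[mu]_t \int[mu]_s (\sum_(k <oo) (G k t * H k s)%:E) =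
   \sum_(k <oo) (5 * 2 ^+ n.+1 * (q k).2 ^+ n.+2)%:E)%E.
  transitivity (\int[mu]_t (\sum_(k <oo) (G k t)%:E * ((2 * (q k).2) ^+ n.+1)%:E))%E.
    apply: eq_integral => t _; rewrite integral_nneseries//; last first.
      by move=> k; exact: (measurableT_comp (mGH k) (pair1_measurable t)).
    apply: eq_eseriesr => k _; rewrite -iH.
    under eq_integral do rewrite EFinM.
    rewrite ge0_integralZl_EFin//; last first.
      by apply/measurable_EFinP; exact: mH.
    by move=> s _; rewrite lee_fin.
  rewrite integral_nneseries//; last 2 first.
  - by move=> k; apply: emeasurable_funM => //; apply/measurable_EFinP; exact: mG.
  - by move=> k t _; rewrite -EFinM lee_fin mulr_ge0// exprn_ge0// mulr_ge0.
  apply: eq_eseriesr => k _; rewrite ge0_integralZr//; last 3 first.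
  - by apply/measurable_EFinP; exact: mG.
  - by move=> t _; rewrite lee_fin.
  - by rewrite lee_fin exprn_ge0// mulr_ge0.
  rewrite iG -EFinM; congr EFin; rewrite exprMn (exprS (q k).2 n.+1).
  by move: (2 ^+ n.+1) ((q k).2 ^+ n.+1) => u w; ring.
pose J k : set R := `](q k).1, (q k).1 + (q k).2[%classic.
apply: (@le_trans _ _ (\sum_(k <oo) (5 * 2 ^+ n.+1 * c `^ (- p))%:E * \int[mu]_(t in J k) (`|dphi t| `^ p)%:E)%E).
  apply: lee_nneseries => [k _ _|k _].
    by rewrite lee_fin mulr_ge0// ?exprn_ge0// mulr_ge0// exprn_ge0.
  case: (qV k) => [->|Vk].
    rewrite expr0n mulr0 mule_ge0//.
      by rewrite lee_fin mulr_ge0 ?powR_ge0// mulr_ge0// exprn_ge0.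
    by apply: integral_ge0 => t _; rewrite lee_fin powR_ge0.
  have /andP[s0 _] := VS _ Vk.
  move/and5P: Vk => [_ _ _ _ h].
  (* On an interval of length [s] the condition is a mean slope of at least [c * s^((n+1)/p)]. Its
     [p]-th power times the length is [c^p * s^(n+2)]. *)
  have := @increment_powR R phi dphi dphiP cdphi p (c * (q k).2 `^ (n.+1%:R / p)) (q k).1 ((q k).1 + (q k).2) p1.
  rewrite mulr_gt0 ?powR_gt0// ltrDl s0 => /(_ erefl erefl).
  rewrite addrAC subrr add0r -{2}(powRr1 (q0 k)) -mulrA -powRD; last by rewrite (gt_eqF s0) implybT.
  move=> /(_ h); rewrite powRM ?(ltW c0) ?powR_ge0// -powRrM divfK ?gt_eqF// powR_mulrn//.
  rewrite -mulrA -exprSr => h2.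
  have c1 : (0 <= (5 * 2 ^+ n.+1 * c `^ (- p))%:E)%E.
    by rewrite lee_fin mulr_ge0 ?powR_ge0// mulr_ge0// exprn_ge0.
  apply: le_trans (lee_wpmul2l c1 h2); rewrite -EFinM lee_fin powRN.
  rewrite le_eqVlt; apply/orP; left; apply/eqP; field.
  by rewrite gt_eqF// powR_gt0.
rewrite nneseriesZl; last first.
  by move=> k _; apply: integral_ge0 => t _; rewrite lee_fin powR_ge0.
apply: lee_wpmul2l.
  by rewrite lee_fin mulr_ge0 ?powR_ge0// mulr_ge0// exprn_ge0.
have mphip (D : set R) : measurable D -> measurable_fun D (fun t => (`|dphi t| `^ p)%:E).
  move=> mD; apply/measurable_EFinP; apply: (measurableT_comp (measurable_powR _)).
  apply: measurable_funTS; apply: measurableT_comp => //.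
  exact: continuous_measurable_fun.
rewrite -ge0_integral_bigcup//; last 2 first.
- by move=> k; exact: measurable_itv.
- by apply: mphip; apply: bigcup_measurable => k _; exact: measurable_itv.
apply: ge0_subset_integral => //.
- by apply: bigcup_measurable => k _; exact: measurable_itv.
- exact: mphip.
(* A selected interval starts in [[0, S]] and has length at most [S], hence stays in [[0, 2 S]];
   default indices give empty intervals. *)
- move=> t [k _]; rewrite /J/= !in_itv/= => /andP[h1 h2].
  case: (qV k) => [h0|]; first by move: h1 h2; rewrite h0 addr0 => h1 h2; have := lt_trans h1 h2; rewrite ltxx.
  by move=> /and5P[? ? ? ? _]; apply/andP; split; lra.
Qed.
End one_dim_estimate.

(** * The gauge of a convex body *)

Lemma closed_measurable_rV {R : realType} n (A : set 'rV[R]_n) :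
  closed A -> measurable A.
Proof. by move/closed_openC/open_measurable_rV/measurableC; rewrite setCK. Qed.

Lemma rV_coord_le_norm {R : realType} n (v : 'rV[R]_n) i : `|v ord0 i| <= `|v|.
Proof. by rewrite [leRHS]mx_normrE; exact: (le_bigmax _ (fun k : _ * _ => `|v k.1 k.2|) (ord0, i)). Qed.

Section gauge.
Context {R : realType} (n : nat) (K : set 'rV[R]_n).
Hypothesis Kbody : convex_body K.
Hypothesis Ksym : origin_symmetric K.
Notation N := (minkowski_functional K).
Let A (h : 'rV[R]_n) := [set l : R | 0 <= l /\ exists2 y, K y & h = l *: y].

Let closedK : closed K.
Proof. by apply: compact_closed; [exact: norm_hausdorff|case: Kbody]. Qed.

Lemma measurable_body : measurable K.
Proof. exact: closed_measurable_rV. Qed.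

Lemma body_bounded : exists2 M : R, 0 < M & forall y, K y -> `|y| <= M.
Proof.
have [cK _] := Kbody.
have /= [M [_ HM]] := compact_bounded cK.
exists (Num.max M 0 + 1); first by rewrite ltr_pwDr// le_max lexx orbT.
by move=> y Ky; apply: HM => //; rewrite ltr_pwDr// le_max lexx.
Qed.

(** Symmetry moves the interior point to the origin: [v] is the midpoint of [x0 + 2 v] and
    [- x0]. *)
Let ballK : exists2 e : R, 0 < e & forall v, `|v| < e -> K v.
Proof.
have [_ [[x0 x0i] cvx]] := Kbody.
have [e /= e0 eK] : nbhs_ball x0 K by apply/nbhs_ballP.
exists (e / 2); first by rewrite divr_gt0.
move=> v ve.
have K0 : K x0 by apply: eK; exact: ballxx.
have K1 : K (x0 + 2 *: v).
  apply: eK; rewrite -ball_normE /ball_/= opprD addrA subrr sub0r normrN normrZ.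
  by rewrite ger0_norm//; lra.
have -> : v = 2^-1 *: (x0 + 2 *: v) + (1 - 2^-1) *: (- x0).
  by apply/rowP => i; rewrite !mxE; field.
by apply: cvx => //; [by apply/Ksym; rewrite opprK|lra].
Qed.

Let K0 : K 0.
Proof. by have [e e0 eK] := ballK; apply: eK; rewrite normr0. Qed.

(** By convexity [K] is star-shaped about 0, so [(l / l') y] stays in [K]. *)
Let A_up h l l' : A h l -> l <= l' -> A h l'.
Proof.
move=> [l0 [y Ky ->]] ll'; split; first exact: le_trans ll'.
have [l'0|l'0] := leP l' 0.
  by exists 0 => //; rewrite scaler0 (_ : l = 0) ?scale0r//; lra.
exists ((l / l') *: y); last by rewrite scalerA mulrCA divff ?mulr1// gt_eqF.
have [_ [_ cvx]] := Kbody.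
have -> : (l / l') *: y = (l / l') *: y + (1 - l / l') *: 0 by rewrite scaler0 addr0.
by apply: cvx => //; apply/andP; split; [rewrite divr_ge0// ltW|rewrite ler_pdivrMr// mul1r].
Qed.

Let A_nonempty h : A h !=set0.
Proof.
have [e e0 eK] := ballK.
(* This factor shrinks [h] to norm below [e]; the [+ 1] keeps it positive when [h = 0]. *)
have l0 : 0 < 2 * (`|h| + 1) / e by rewrite divr_gt0// mulr_gt0// ltr_pwDr.
exists (2 * (`|h| + 1) / e); split; first exact: ltW.
exists ((2 * (`|h| + 1) / e)^-1 *: h); last by rewrite scalerA mulfV ?scale1r// gt_eqF.
apply: eK; rewrite normrZ gtr0_norm ?invr_gt0// invf_div mulrAC ltr_pdivrMr ?mulr_gt0 ?ltr_pwDr//.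
by have := normr_ge0 h; nra.
Qed.

Let A_lb h : has_lbound (A h).
Proof. by exists 0 => l [l0 _]. Qed.

Let N_lt h l : N h < l -> A h l.
Proof. by move=> /(inf_lt (A_nonempty h))[l' Al' /ltW]; exact: A_up. Qed.

Let N_le h l : A h l -> N h <= l.
Proof. by move=> Al; apply: (ge_inf (A_lb h)). Qed.

Let N_ge h x : (forall l, A h l -> x <= l) -> x <= N h.
Proof. exact: (lb_le_inf (A_nonempty h)). Qed.

Lemma gauge_ge0 h : 0 <= N h.
Proof. by apply: N_ge => l []. Qed.

Lemma gauge0 : N 0 = 0.
Proof.
apply/eqP; rewrite eq_le gauge_ge0 andbT; apply: N_le; split => //.
by exists 0 => //; rewrite scaler0.
Qed.

Lemma norm_le_gauge : exists2 M : R, 0 < M & forall h, `|h| <= M * N h.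
Proof.
have [M M0 HM] := body_bounded; exists M => // h.
rewrite -ler_pdivrMl//; apply: N_ge => l [l0 [y Ky ->]].
by rewrite normrZ ger0_norm// ler_pdivrMl// mulrC ler_wpM2r// HM.
Qed.

Lemma gauge_gt0 h : h != 0 -> 0 < N h.
Proof.
have [M M0 HM] := norm_le_gauge; move=> h0.
by rewrite -(pmulr_rgt0 _ M0) (lt_le_trans _ (HM h))// normr_gt0.
Qed.

(** One inequality for all positive factors is enough; used at [s^-1] it yields the other. *)
Lemma gaugeZ s h : 0 < s -> N (s *: h) = s * N h.
Proof.
have H r k : 0 < r -> N (r *: k) <= r * N k.
  move=> r0; rewrite -ler_pdivrMl//; apply: N_ge => l [l0 [y Ky ->]].
  rewrite ler_pdivrMl//; apply: N_le; split; first by rewrite mulr_ge0// ltW.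
  by exists y => //; rewrite scalerA.
move=> s0; apply/eqP; rewrite eq_le H//= -ler_pdivlMl//.
have := H s^-1 (s *: h); rewrite scalerA mulVf ?gt_eqF// scale1r; apply.
by rewrite invr_gt0.
Qed.

Lemma gaugeN h : N (- h) = N h.
Proof.
have H k : N (- k) <= N k.
  apply: N_ge => l [l0 [y Ky ->]]; apply: N_le; split => //.
  by exists (- y); [by apply/Ksym; rewrite opprK|rewrite scalerN].
by apply/eqP; rewrite eq_le H/= -{1}(opprK h) H.
Qed.

(** The infimum need not be known to be attained: [t h] is in [K] for all [0 < t < 1], and [K] is
    closed. *)
Lemma gauge_le1 h : (N h <= 1) = `[< K h >].
Proof.
apply/idP/asboolP => [Nh|Kh]; last by apply: N_le; split => //; exists h; rewrite ?scale1r.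
have Kt t : 0 < t < 1 -> K (t *: h).
  move=> /andP[t0 t1].
  have /N_lt[_ [y Ky ->]] : N h < t^-1 by rewrite (le_lt_trans Nh)// invf_gt1.
  by rewrite scalerA mulfV ?scale1r// gt_eqF.
have c : t *: h @[t --> 1^'-] --> (1 : R) *: h.
  by apply: cvg_at_left_filter; apply: cvgZl; exact: cvg_id.
rewrite scale1r in c; apply: (closed_cvg K closedK _ h c); near=> t; apply: Kt; apply/andP; split; near: t; last exact: nbhs_left_lt.
exact: nbhs_left_gt.
Unshelve. all: by end_near. Qed.

Lemma gauge_le r h : 0 < r -> (N h <= r) = `[< K (r^-1 *: h) >].
Proof.
by move=> r0; rewrite -gauge_le1 gaugeZ ?invr_gt0// ler_pdivrMl// mulr1.
Qed.

(** The sublevel set at [x] is a dilate of [K] for [x > 0], the origin for [x = 0], and empty for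
    [x < 0]. *)
Lemma measurable_gauge : measurable_fun setT N.
Proof.
apply: (measurability _ (RGenOInfty.measurableE R)).
move=> _ [_ [x ->] <-]; rewrite setTI.
rewrite (_ : _ @^-1` _ = ~` [set h | N h <= x]); last first.
  by apply/seteqP; split => h /=; rewrite in_itv/= andbT ltNge => /negP.
apply: measurableC.
have [x0|] := ltP 0 x.
  rewrite (_ : [set h | _] = (fun h => x^-1 *: h + 0) @^-1` K).
    by rewrite -[X in measurable X]setTI; apply: measurable_affine_rV => //; exact: measurable_body.
  apply/seteqP; split => h /=; rewrite gauge_le// addr0; first by move/asboolP.
  by move=> ?; apply/asboolP.
rewrite le_eqVlt => /predU1P[->|x0].
  rewrite (_ : [set h | _] = [set 0]); first exact: measurable_rV_set0.
  apply/seteqP; split => h /=; last by move=> ->; rewrite gauge0.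
  by move=> Nh; apply: contrapT => /eqP/gauge_gt0; rewrite ltNge Nh.
rewrite (_ : [set h | _] = set0)//; apply/seteqP; split => // h /=.
by move=> Nh; have := le_lt_trans Nh x0; rewrite ltNge gauge_ge0.
Qed.

End gauge.

(** * Smooth functions with compact support *)

Section smooth.
Context {R : realType} (n : nat) (f : 'rV[R]_n -> R).
Hypothesis fsm : smooth_compact_support f.

Lemma smooth_continuous : continuous f.
Proof. by case: fsm => /(_ 0%N). Qed.

Lemma smooth_derivable a v : derivable f a v.
Proof. by case: fsm => /(_ 1%N)[_ [h _]] _; exact: h. Qed.

Lemma smooth_derive_continuous v : continuous ('D_v f).
Proof. by case: fsm => /(_ 1%N)[_ [_ h]] _; exact: h. Qed.

Lemma smooth_is_derive_line (x v : 'rV[R]_n) (t : R) :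
  is_derive t 1 (fun t => f (x + t *: v)) ('D_v f (x + t *: v)).
Proof.
have E : (fun h : R => h^-1 *: (((fun t => f (x + t *: v)) \o shift t) (h *: 1) - f (x + t *: v))) =
  (fun h : R => h^-1 *: ((f \o shift (x + t *: v)) (h *: v) - f (x + t *: v))).
  apply/funext => h /=; congr (_ *: (f _ - _)).
  by rewrite [h *: 1]mulr1 scalerDl addrCA.
split; first by rewrite /derivable E; exact: smooth_derivable.
by rewrite /derive E.
Qed.

Lemma smooth_deriveZ c x v : 'D_(c *: v) f x = c * 'D_v f x.
Proof.
have [_ <-] : is_derive (0:R) 1 (fun t => f (x + t *: (c *: v))) (c * 'D_v f x).
  have D1 := smooth_is_derive_line x v (c * 0).
  have D2 : is_derive (0:R) 1 (fun t : R => c * t) c.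
    by apply: is_derive_eq; rewrite /GRing.scale/= mulr1.
  have := @is_derive1_comp _ (fun t => f (x + t *: v)) (fun t => c * t) 0 _ _ D1 D2.
  rewrite mulr0 scale0r addr0 mulrC.
  by congr is_derive; apply/funext => t /=; rewrite scalerA mulrC.
by have [_ ->] := smooth_is_derive_line x (c *: v) 0; rewrite scale0r addr0.
Qed.

(** Split the increment along [h (u + v)] at [x + h u]. By the mean value theorem the second part is
    [h] times ['D_v f] at a point close to [x], and continuity of ['D_v f] concludes. Limits from
    the right suffice to identify the derivative and keep the segment in the form [[0, h]]. *)
Lemma smooth_deriveD x u v : 'D_(u + v) f x = 'D_u f x + 'D_v f x.
Proof.
have q w : h^-1 *: (f (h *: w + x) - f x) @[h --> 0^'+] --> 'D_w f x.
  by apply: cvg_dnbhs_at_right; exact: smooth_derivable.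
apply: (cvg_unique _ (q (u + v))) => //.
pose G (h : R) := h^-1 *: (f (x + h *: u + h *: v) - f (x + h *: u)).
have GE : (fun h => h^-1 *: (f (h *: (u + v) + x) - f x)) =
          (fun h => h^-1 *: (f (h *: u + x) - f x) + G h).
  apply/funext => h; rewrite /G -scalerDr; congr (_ *: _).
  rewrite [RHS]addrC (addrC (h *: u) x) addrA subrK scalerDr.
  by rewrite [_ + _ + x]addrC addrA.
rewrite GE; apply: cvgD; first exact: q.
apply/cvgrPdist_le => e e0.
have /cvgrPdist_le/(_ e e0)/nbhs_ballP[d /= d0 dP] := @smooth_derive_continuous v x.
have M0 : 0 < `|u| + `|v| + 1 by rewrite ltr_pwDr// addr_ge0.
near=> h.
have h0 : 0 < h by near: h; exact: nbhs_right_gt.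
have hd : h < d / (`|u| + `|v| + 1) by near: h; apply: nbhs_right_lt; rewrite divr_gt0.
have [c] := @MVT_segment _ (fun t => f (x + h *: u + t *: v))
  (fun t => 'D_v f (x + h *: u + t *: v)) 0 h (ltW h0)
  (fun t _ => smooth_is_derive_line (x + h *: u) v t)
  (continuous_subspaceT (continuous_prim (smooth_is_derive_line (x + h *: u) v))).
rewrite in_itv/= scale0r addr0 subr0 => /andP[c0 ch] cE.
rewrite /G cE /GRing.scale/= mulrCA mulVf ?mulr1 ?gt_eqF//.
apply: dP; rewrite -ball_normE /ball_/= -addrA opprD addNKr normrN.
rewrite (le_lt_trans (ler_normD _ _))// !normrZ (gtr0_norm h0) (ger0_norm c0).
move: hd; rewrite ltr_pdivlMr//; apply: le_lt_trans.
by have := normr_ge0 v; have := normr_ge0 u; nra.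
Unshelve. all: by end_near. Qed.

Lemma smooth_derive_sum (I : Type) (r : seq I) (u : I -> 'rV[R]_n) x :
  'D_(\sum_(i <- r) u i) f x = \sum_(i <- r) 'D_(u i) f x.
Proof.
elim: r => [|i r IH]; last by rewrite !big_cons smooth_deriveD IH.
by rewrite !big_nil -(scale0r (0 : 'rV[R]_n)) smooth_deriveZ mul0r.
Qed.

Lemma smooth_derive_dotp x v : 'D_v f x = dotp (gradient f x) v.
Proof.
rewrite {1}(row_sum_delta v) smooth_derive_sum /dotp.
by apply: eq_bigr => i _; rewrite smooth_deriveZ mxE mulrC.
Qed.

Lemma smooth_support : exists2 M : R, 0 < M & forall x, M < `|x| -> f x = 0.
Proof.
have [_ /compact_bounded] := fsm; move=> [M [_ HM]].
exists (Num.max M 0 + 1); first by rewrite ltr_pwDr// le_max lexx orbT.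
move=> x Mx; apply: contrapT => /eqP fx.
suff : `|x| <= Num.max M 0 + 1 by rewrite leNgt Mx.
apply: HM; first by rewrite ltr_pwDr// le_max lexx.
exact: subset_closure.
Qed.

Lemma smooth_derive_support M v : (forall x, M < `|x| -> f x = 0) ->
  forall x, M < `|x| -> 'D_v f x = 0.
Proof.
move=> fM x Mx.
rewrite (@near_eq_derive _ _ _ f (cst 0) x v) ?derive_cst//.
near=> y; apply: fM; near: y.
have : continuous (fun y : 'rV[R]_n => `|y|) by exact: norm_continuous.
by move=> /(_ x)/cvgr_gt; apply.
Unshelve. all: by end_near. Qed.

Lemma continuous_bounded_ball (g : 'rV[R]_n -> R) (M : R) : continuous g ->
  exists2 L, 0 < L & forall x, `|x| <= M -> `|g x| <= L.
Proof.
move=> cg; pose B := [set x : 'rV[R]_n | `|x| <= M].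
have cB : compact B.
  apply: bounded_closed_compact.
    by exists M; split; [exact: num_real|move=> y My x /le_trans; apply; exact: ltW].
  have -> : B = (fun x : 'rV[R]_n => `|x|) @^-1` [set r | r <= M] by [].
  by apply: preimage_closed; [move=> y _; exact: norm_continuous|exact: closed_le].
have /compact_bounded[L [_ HL]] : compact (g @` B).
  by apply: continuous_compact => //; exact: continuous_subspaceT.
exists (Num.max L 0 + 1); first by rewrite ltr_pwDr// le_max lexx orbT.
move=> x xB; apply: HL; first by rewrite ltr_pwDr// le_max lexx.
by exists x.
Qed.

Lemma smooth_bounded : exists2 L : R, 0 < L & forall x, `|f x| <= L.
Proof.
have [M M0 fM] := smooth_support.
have [L L0 HL] := continuous_bounded_ball M smooth_continuous.
exists L => // x; have [/HL//|/fM ->] := leP `|x| M.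
by rewrite normr0 ltW.
Qed.

Lemma smooth_gradient_bounded :
  exists2 L : R, 0 < L & forall x i, `|gradient f x ord0 i| <= L.
Proof.
have [M M0 fM] := smooth_support.
have h i : exists L, 0 < L /\ forall x, `|gradient f x ord0 i| <= L.
  have [L L0 HL] := continuous_bounded_ball M (@smooth_derive_continuous (delta_mx ord0 i)).
  exists L; split => // x; rewrite mxE; have [/HL//|/(smooth_derive_support _ fM) ->] := leP `|x| M.
  by rewrite normr0 ltW.
have [L HL] := choice h.
exists (\sum_i L i + 1).
  by rewrite ltr_pwDr// sumr_ge0// => i _; exact/ltW/(HL i).1.
move=> x i; rewrite (le_trans ((HL i).2 x))// (bigD1 i)//= -addrA lerDl addr_ge0//.
by rewrite sumr_ge0// => j _; exact/ltW/(HL j).1.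
Qed.

(** The norm on row vectors is the maximum norm, whence the factor [n]. *)
Lemma dotp_le (z y : 'rV[R]_n) (L : R) : (forall i, `|z ord0 i| <= L) ->
  `|dotp z y| <= n%:R * L * `|y|.
Proof.
move=> zL; rewrite (le_trans (ler_norm_sum _ _ _))//.
rewrite (le_trans (ler_sum _ (G := fun=> L * `|y|) _))//.
  move=> i _; rewrite normrM; apply: ler_pM => //; exact: rV_coord_le_norm.
by rewrite sumr_const card_ord -mulrA mulr_natl.
Qed.

Lemma smooth_lipschitz : exists2 L : R, 0 < L &
  forall x h, `|f (x + h) - f x| <= L * `|h|.
Proof.
have [L L0 HL] := smooth_gradient_bounded.
exists (n%:R * L + 1); first by rewrite ltr_pwDr// mulr_ge0// ltW.
move=> x h.
have [c _] := @MVT_segment _ (fun t => f (x + t *: h))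
  (fun t => 'D_h f (x + t *: h)) 0 1 ler01
  (fun t _ => smooth_is_derive_line x h t)
  (continuous_subspaceT (continuous_prim (smooth_is_derive_line x h))).
rewrite scale0r addr0 scale1r subr0 mulr1 => ->.
rewrite smooth_derive_dotp (le_trans (dotp_le _ (HL _)))//.
by rewrite ler_wpM2r// lerDl.
Qed.

Lemma measurable_gradient : measurable_fun setT (gradient f).
Proof.
apply: measurable_fun_rV => i; under eq_fun do rewrite mxE.
by apply: continuous_measurable_rV; exact: smooth_derive_continuous.
Qed.

End smooth.

(** * Moments of a convex body *)

Lemma integral_exprn {R : realType} (n : nat) (T : R) : 0 <= T ->
  (\int[@lebesgue_measure R]_s (((0 < s) && (s <= T))%:R * s ^+ n)%:E
   = (T ^+ n.+1 / n.+1%:R)%:E)%E.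
Proof.
rewrite le_eqVlt => /predU1P[<-|T0].
  rewrite integral0_eq ?expr0n ?mul0r// => s _.
  by case: (ltrP 0 s) => s0; rewrite /= ?mul0r// leNgt s0 mul0r.
transitivity (\int[@lebesgue_measure R]_s ((fun s => (s ^+ n)%:E) \_ `]0%R, T]) s)%E.
  apply: eq_integral => s _; rewrite patchE mem_setE in_itv/=.
  by case: ifPn => _; rewrite ?mul1r ?mul0r.
rewrite -integral_mkcond integral_itv_obnd_cbnd; last exact/measurable_EFinP.
have dF (x : R) : is_derive x 1 (fun s : R => n.+1%:R^-1 * s ^+ n.+1) (x ^+ n).
  have := is_deriveZ n.+1%:R^-1 (is_deriveX n.+1 (is_derive_id x 1)).
  rewrite /GRing.scale/= mulr1 mulKf ?pnatr_eq0//.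
  by congr is_derive; apply/funext => s; rewrite /= exprfctE.
rewrite (@continuous_FTC2 _ (fun s => s ^+ n) (fun s => n.+1%:R^-1 * s ^+ n.+1))//.
- by rewrite expr0n mulr0 sube0 mulrC.
- by apply: continuous_subspaceT => x; exact: exprn_continuous.
- have cF := continuous_prim dF; split=> [x _||]; first by case: (dF x).
    exact/cvg_at_right_filter/cF.
  exact/cvg_at_left_filter/cF.
- by move=> x _; rewrite derive1E; case: (dF x).
Qed.

Lemma measurable_dotp {R : realType} n d (T : measurableType d) (u v : T -> 'rV[R]_n) :
  measurable_fun setT u -> measurable_fun setT v ->
  measurable_fun setT (fun x => dotp (u x) (v x)).
Proof.
move=> mu mv; apply: measurable_sum => i; apply: measurable_funM.
  exact: (measurableT_comp (measurable_coord i) mu).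
exact: (measurableT_comp (measurable_coord i) mv).
Qed.

Lemma dotpZr {R : realType} n (z m : 'rV[R]_n) (s : R) :
  dotp z (s *: m) = s * dotp z m.
Proof.
by rewrite /dotp mulr_sumr; apply: eq_bigr => i _; rewrite mxE mulrCA.
Qed.

Lemma measurable_rV_eq0 {R : realType} n :
  measurable_fun setT (fun v : 'rV[R]_n => v != 0).
Proof.
apply: (measurableT_comp (f := negb)) => //.
apply: (measurable_fun_bool true).
rewrite setTI (_ : _ @^-1` _ = [set 0]); first exact: measurable_rV_set0.
by apply/seteqP; split => v /= /eqP.
Qed.

Section body.
Context {R : realType} (n : nat) (K : set 'rV[R]_n.+1) (p : R).
Hypothesis Kbody : convex_body K.
Hypothesis Ksym : origin_symmetric K.
Hypothesis p1 : 1 <= p.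
Notation mu := (@lebesgue_measure R).
Notation N := (minkowski_functional K).
Notation V := 'rV[R]_n.+1.
Notation muV := (@rV_measure R n.+1).
Local Notation al := (n.+1%:R / p + 1).

Let p0 : 0 < p. Proof. by apply: lt_le_trans p1. Qed.
Let np : 0 < n.+1%:R + p. Proof. by rewrite addr_gt0. Qed.

(** The integral of [|z . y|^p] over [K], without the normalisation of [normZpK]. Membership in [K]
    is expressed by the gauge, as in [integral_polar]. *)
Definition moment (z : V) : \bar R :=
  (\int[muV]_y ((N y <= 1)%R%:R * `|dotp z y| `^ p)%:E)%E.

Let mN := measurable_gauge Kbody Ksym.

Let mmom : measurable_fun setT
  (fun zy : V * V => ((N zy.2 <= 1)%R%:R * `|dotp zy.1 zy.2| `^ p)%:E).
Proof.
apply/measurable_EFinP; apply: measurable_funM.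
  apply: measurable_bool_natr; apply: measurable_fun_ler => //.
  exact: (measurableT_comp mN measurable_snd).
apply: (measurableT_comp (measurable_powR _)); apply: measurableT_comp => //.
by apply: measurable_dotp.
Qed.

Let mom_ge0 (z y : V) : (0 <= ((N y <= 1)%R%:R * `|dotp z y| `^ p)%:E)%E.
Proof. by rewrite lee_fin mulr_ge0// powR_ge0. Qed.

Lemma moment_ge0 z : (0 <= moment z)%E.
Proof. by apply: integral_ge0 => y _; exact: mom_ge0. Qed.

Lemma measurable_moment : measurable_fun setT moment.
Proof. exact: (@measurable_fun_param_integral _ _ _ _ _ muV _ mom_ge0 mmom). Qed.

Lemma moment_fin z : moment z \is a fin_num.
Proof.
rewrite ge0_fin_numE ?moment_ge0//.
have [M M0 HM] := norm_le_gauge Kbody Ksym.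
pose B := [set v : V | forall i, `|v ord0 i| <= M].
have mB : measurable B by exact: measurable_box.
pose L := \sum_i `|z ord0 i|.
have L0 : 0 <= L by exact: sumr_ge0.
pose c := (n.+1%:R * L * M) `^ p.
apply: (@le_lt_trans _ _ (\int[muV]_(y in B) (cst c%:E) y)%E).
  rewrite [leRHS]integral_mkcond; apply: ge0_le_integral => //.
  - exact: (measurableT_comp mmom (pair1_measurable z)).
  - by apply/(measurable_restrictT _ mB).
  move=> y _; rewrite patchE.
  have Ny : N y <= 1 -> `|y| <= M.
    by move=> h; rewrite (le_trans (HM y))// ger_pMr.
  case: ifPn => yB.
    rewrite lee_fin; case: (N y <= 1) Ny => [/(_ erefl) yM|_]; last by rewrite mul0r powR_ge0.
    rewrite mul1r; apply: ge0_ler_powR; rewrite ?nnegrE ?(ltW p0)//.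
      by rewrite !mulr_ge0// ltW.
    have zL i : `|z ord0 i| <= L.
      by rewrite /L (bigD1 i)//= lerDl sumr_ge0.
    by rewrite (le_trans (dotp_le y zL))// ler_wpM2l// mulr_ge0.
  case: (N y <= 1) Ny => [/(_ erefl) yM|_]; last by rewrite mul0r.
  move: yB; rewrite notin_setE => -[] i.
  by rewrite (le_trans (rV_coord_le_norm _ _)).
rewrite integral_cst// lte_mul_pinfty//.
- by rewrite lee_fin powR_ge0.
- exact: rV_measure_box.
Qed.

Let r : R := n.+1%:R / p.
Let r0 : 0 < r. Proof. by rewrite divr_gt0. Qed.

Let powR_leV s B : 0 < s -> 0 <= B -> (s `^ r <= B) = (s <= B `^ r^-1).
Proof.
move=> s0 B0; have ri : 0 <= r^-1 by rewrite invr_ge0 ltW.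
apply/idP/idP => h.
  rewrite -[s](powRr1 (ltW s0)) -(mulfV (lt0r_neq0 r0)) (powRrM s r).
  by apply: ge0_ler_powR; rewrite ?nnegrE ?powR_ge0.
rewrite -[B](powRr1 B0) -(mulVf (lt0r_neq0 r0)) (powRrM B r^-1).
by apply: ge0_ler_powR; rewrite ?nnegrE ?powR_ge0// ltW.
Qed.

Let powR_eqV s B : 0 < s -> 0 <= B -> s `^ r = B -> s = B `^ r^-1.
Proof.
move=> s0 B0 <-; rewrite -(powRrM s r) mulfV ?(powRr1 (ltW s0))//; exact: lt0r_neq0.
Qed.

(** Since [al = r + 1], one factor [s] cancels in [N (s m)^al <= |z . (s m)|] and the condition
    reads [s^r <= |z . m| / N m^al]. This is the threshold for [s] on the ray through [m]. *)
Let radius (z m : V) : R := (`|dotp z m| / N m `^ al) `^ r^-1.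

Let gauge_scale s m : 0 < s -> m != 0 -> N (s *: m) `^ al = s * (s `^ r * N m `^ al).
Proof.
move=> s0 m0; rewrite (gaugeZ Kbody Ksym)// powRM ?(ltW s0) ?(gauge_ge0 Kbody Ksym)//.
by rewrite powRD ?(gt_eqF s0) ?implybT// (powRr1 (ltW s0)) mulrA [s * _]mulrC.
Qed.

Let Nal m : m != 0 -> 0 < N m `^ al.
Proof. by move=> m0; rewrite powR_gt0// (gauge_gt0 Kbody Ksym). Qed.

Let radius_le z s m : 0 < s -> m != 0 ->
  (N (s *: m) `^ al <= `|dotp z (s *: m)|) = (s <= radius z m).
Proof.
move=> s0 m0; rewrite gauge_scale// dotpZr normrM (gtr0_norm s0) ler_pM2l//.
by rewrite -ler_pdivlMr ?Nal// powR_leV// divr_ge0// powR_ge0.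
Qed.

Let radius_eq z s m : 0 < s -> m != 0 ->
  N (s *: m) `^ al = `|dotp z (s *: m)| -> s = radius z m.
Proof.
move=> s0 m0; rewrite gauge_scale// dotpZr normrM (gtr0_norm s0).
move=> /(mulfI (lt0r_neq0 s0)) E; apply: powR_eqV => //.
  by rewrite divr_ge0// powR_ge0.
by rewrite -E mulfK// gt_eqF// Nal.
Qed.

(** The reason for [a = n.+1 + p] in the polar formula: as [al * p = n.+1 + p], the gauge
    disappears. *)
Let radiusX z m : m != 0 ->
  N m `^ (n.+1%:R + p) * radius z m ^+ n.+1 = `|dotp z m| `^ p.
Proof.
move=> m0; rewrite /radius -powR_mulrn ?powR_ge0// -powRrM.
have -> : r^-1 * n.+1%:R = p by rewrite /r invf_div divfK// pnatr_eq0.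
have -> : (`|dotp z m| / N m `^ al) `^ p = `|dotp z m| `^ p * N m `^ (- al * p).
  by rewrite -powRN (powRM p (normr_ge0 _) (powR_ge0 _ _)) -(powRrM (N m)).
rewrite mulrCA -powRD; last by rewrite (gt_eqF (gauge_gt0 Kbody Ksym m0)) implybT.
rewrite (_ : n.+1%:R + p + _ = 0) ?powRr0 ?mulr1//.
by rewrite mulNr mulrDl divfK ?(lt0r_neq0 p0)// mul1r subrr.
Qed.

Let measurable_gauge_powR : measurable_fun setT (fun k : V => N k `^ al).
Proof. exact: (measurableT_comp (measurable_powR _) mN). Qed.

Let measurable_dotp_norm z : measurable_fun setT (fun k : V => `|dotp z k|).
Proof. by apply: measurableT_comp => //; exact: measurable_dotp. Qed.

(** On the ray through [m] the set is the segment [0 < s <= radius z m], which contributes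
    [radius z m ^+ n.+1 / n.+1]; [radiusX] then turns the weighted integral into the moment. At
    [m = 0] the weight vanishes. *)
Lemma volume_moment z :
  (\int[muV]_k ((k != 0%R) && (N k `^ al <= `|dotp z k|)%R)%:R%:E
   = ((n.+1%:R + p) / n.+1%:R)%:E * moment z)%E.
Proof.
rewrite (integral_polar mN (gauge_gt0 Kbody Ksym) (gaugeZ Kbody Ksym) np)//; last first.
  apply/measurable_EFinP; apply: measurable_bool_natr; apply: measurable_and.
    exact: measurable_rV_eq0.
  exact: measurable_fun_ler.
rewrite EFinM -muleA; congr (_ * _)%E.
rewrite -ge0_integralZl_EFin//; last exact: (measurableT_comp mmom (pair1_measurable z)).
apply: eq_integral => m _; have [->|m0] := eqVneq m 0.
  rewrite (gauge0 Kbody Ksym) powR0 ?gt_eqF// mulr0 mul0e.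
  rewrite (_ : dotp z 0 = 0); last by rewrite -(scale0r 0) dotpZr mul0r.
  by rewrite normr0 powR0 ?gt_eqF// mulr0 mule0.
transitivity (((N m <= 1)%R%:R * N m `^ (n.+1%:R + p))%:E *
    (radius z m ^+ n.+1 / n.+1%:R)%:E)%E.
  congr (_ * _)%E; rewrite -integral_exprn ?powR_ge0//.
  apply: eq_integral => s _; rewrite -EFinM; congr EFin.
  have [s0|s0] := ltrP 0 s; last by rewrite !mul0r.
  by rewrite scaler_eq0 (gt_eqF s0) (negbTE m0)/= radius_le// mul1r mulrC.
rewrite -!EFinM; congr EFin; rewrite -radiusX//.
by move: (_ `^ _) (_ ^+ _) => u v; ring.
Qed.

(** By [radius_eq] a ray meets this set in at most one point, so each inner integral of the polar
    formula is zero. The origin, where equality always holds, is left out. *)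
Lemma tie_null z :
  (\int[muV]_k ((k != 0%R) && (N k `^ al == `|dotp z k|)%R)%:R%:E = 0)%E.
Proof.
have mt : measurable_fun setT (fun k : V => (k != 0%R) && (N k `^ al == `|dotp z k|)).
  apply: measurable_and; first exact: measurable_rV_eq0.
  exact: measurable_fun_eqr.
rewrite (integral_polar mN (gauge_gt0 Kbody Ksym) (gaugeZ Kbody Ksym) np)//; last first.
  exact/measurable_EFinP/measurable_bool_natr.
rewrite integral0_eq ?mule0// => m _.
rewrite [X in (_ * X)%E](_ : _ = 0%E) ?mule0//.
pose g (s : R) : R := (0 < s)%R%:R * s ^+ n *
  ((s *: m != 0) && (N (s *: m) `^ al == `|dotp z (s *: m)|))%:R.
transitivity (\int[mu]_s (g s)%:E)%E; first exact: eq_integral.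
have g0 s : 0 <= g s.
  rewrite /g; have [s0|] := ltrP 0 s; last by rewrite !mul0r.
  by rewrite mul1r mulr_ge0// exprn_ge0// ltW.
have gT s : s != radius z m -> g s = 0.
  rewrite /g; have [s0|] := ltrP 0 s; last by rewrite !mul0r.
  rewrite scaler_eq0 (gt_eqF s0)/=; have [->|m0] := eqVneq m 0; first by rewrite mulr0.
  have [/radius_eq ->//|_] := eqVneq (N (s *: m) `^ al) `|dotp z (s *: m)|.
    by rewrite eqxx.
  by rewrite mulr0.
transitivity (\int[mu]_(s in [set radius z m]) (g s)%:E)%E; last exact: integral_set1.
rewrite [RHS]integral_mkcond; apply: eq_integral => s _; rewrite patchE.
by case: ifPn => //; rewrite notin_setE => /eqP/gT ->.
Qed.

End body.

(** * Level sets and the upper bound *)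

Section level_sets.
Context {R : realType} (n : nat) (K : set 'rV[R]_n.+1) (p : R) (f : 'rV[R]_n.+1 -> R).
Hypothesis Kbody : convex_body K.
Hypothesis Ksym : origin_symmetric K.
Hypothesis p1 : 1 <= p.
Hypothesis fsm : smooth_compact_support f.
Notation mu := (@lebesgue_measure R).
Notation N := (minkowski_functional K).
Notation V := 'rV[R]_n.+1.
Notation muV := (@rV_measure R n.+1).
Local Notation al := (n.+1%:R / p + 1).

Let p0 : 0 < p. Proof. by apply: lt_le_trans p1. Qed.
Let np : 0 < n.+1%:R + p. Proof. by rewrite addr_gt0. Qed.
Let mN := measurable_gauge Kbody Ksym.
Let N_ge0 := gauge_ge0 Kbody Ksym.
Let N_gt0 := gauge_gt0 Kbody Ksym.
Let NZ := gaugeZ Kbody Ksym.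
Let mf : measurable_fun setT f := continuous_measurable_rV (smooth_continuous fsm).

Definition energy : \bar R := (\int[muV]_x moment K p (gradient f x))%E.

Let mmomg : measurable_fun setT (fun x => moment K p (gradient f x)).
Proof.
exact: (measurableT_comp (measurable_moment p Kbody Ksym) (measurable_gradient fsm)).
Qed.

Lemma normZpK_powR z :
  ((normZpK p K z `^ p)%:E = ((n.+1%:R + p) / 2)%:E * moment K p z)%E.
Proof.
have mF : measurable_fun setT (fun y : V => (\1_K y * `|dotp z y| `^ p)%:E).
  apply/measurable_EFinP; apply: measurable_funM.
    by apply: measurable_indic; exact: measurable_body.
  apply: (measurableT_comp (measurable_powR _)); apply: measurableT_comp => //.
  exact: measurable_dotp.
have iE : iint (fun y => (\1_K y * `|dotp z y| `^ p)%:E) = moment K p z.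
  rewrite iintE//.
  apply: eq_integral => y _; congr (_ * _)%:E.
  by rewrite indicE (gauge_le1 Kbody Ksym); congr (_%:R); apply/idP/asboolP; rewrite inE.
rewrite /normZpK iE -powRrM mulVf ?(lt0r_neq0 p0)// powRr1.
  by rewrite EFinM fineK// moment_fin.
by rewrite mulr_ge0 ?divr_ge0 ?(ltW np)// fine_ge0// moment_ge0.
Qed.

Lemma iint_normZpK : iint (fun x => (normZpK p K (gradient f x) `^ p)%:E) =
  (((n.+1%:R + p) / 2)%:E * energy)%E.
Proof.
have -> : (fun x => (normZpK p K (gradient f x) `^ p)%:E) =
    (fun x => ((n.+1%:R + p) / 2)%:E * moment K p (gradient f x))%E.
  by apply/funext => x; exact: normZpK_powR.
have c0 : 0 <= (n.+1%:R + p) / 2 by rewrite divr_ge0// ltW.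
rewrite iintE; last 2 first.
- exact: measurable_funeM.
- by move=> x; rewrite mule_ge0// moment_ge0.
by rewrite ge0_integralZl_EFin// => x _; exact: moment_ge0.
Qed.

(** The level set in the variables [x] and [h = y - x], with the denominator cleared. *)
Definition jump (lam : R) (x h : V) : bool :=
  (h != 0) && (lam * N h `^ al <= `|f (x + h) - f x|).

Lemma measurable_jump (lam : R) : measurable_fun setT (fun z : V * V => jump lam z.1 z.2).
Proof.
have m1 : measurable_fun setT (fun z : V * V => z.1) by exact: measurable_fst.
have m2 : measurable_fun setT (fun z : V * V => z.2) by exact: measurable_snd.
apply: measurable_and; first exact: (measurableT_comp (@measurable_rV_eq0 R n.+1) m2).
apply: measurable_fun_ler.
  apply: measurable_funM => //.
  exact: (measurableT_comp (measurable_powR _) (measurableT_comp mN m2)).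
apply: measurableT_comp => //; apply: measurable_funB.
  apply: (measurableT_comp mf); apply: measurable_fun_rV => i.
  under eq_fun do rewrite mxE.
  apply: measurable_funD.
    exact: (measurableT_comp (measurable_coord i) m1).
  exact: (measurableT_comp (measurable_coord i) m2).
exact: (measurableT_comp mf m1).
Qed.

Let mjump (lam : R) : measurable_fun setT (fun z : V * V => ((jump lam z.1 z.2)%:R : R)%:E).
Proof. by apply/measurable_EFinP/measurable_bool_natr; exact: measurable_jump. Qed.

Let jump_ge0 (lam : R) x h : (0 <= ((jump lam x h)%:R : R)%:E)%E.
Proof. by rewrite lee_fin. Qed.

Lemma leb2n_jump (lam : R) : 0 < lam ->
  leb2n [set xy : V * V | xy.1 <> xy.2 /\
    lam <= `|(f xy.1 - f xy.2) / N (xy.1 - xy.2) `^ al|] =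
  (\int[muV]_x \int[muV]_h ((jump lam x h)%:R : R)%:E)%E.
Proof.
move=> l0; rewrite /leb2n.
set E := [set xy : V * V | _].
have EE x y : \1_E (x, y) = (jump lam x (y - x))%:R :> R.
  rewrite indicE; congr ((nat_of_bool _)%:R); rewrite /jump subr_eq0 (addrC x) subrK.
  have [->|yx] := eqVneq y x.
    by apply: negbTE; apply/negP => /set_mem[].
  rewrite /=; have xy0 : x - y != 0 by rewrite subr_eq0 eq_sym.
  rewrite -(gaugeN Kbody Ksym (y - x)) opprB.
  have -> : ((x, y) \in E) = (lam <= `|(f x - f y) / N (x - y) `^ al|).
    apply/idP/idP => [/set_mem[]//|?]; apply/mem_set; split => //=.
    by move=> /esym/eqP; apply/negP.
  rewrite normrM normfV [`|N _ `^ _|]ger0_norm ?powR_ge0//.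
  by rewrite ler_pdivlMr ?powR_gt0 ?N_gt0// distrC.
have mjx x : measurable_fun setT (fun h => ((jump lam x h)%:R : R)%:E).
  exact: (measurableT_comp (mjump lam) (pair1_measurable x)).
have -> : (fun x => iint (fun y => (\1_E (x, y))%:E)) =
   (fun x => \int[muV]_h ((jump lam x h)%:R : R)%:E)%E.
  apply/funext => x.
  (* The form [1 *: y - x] is the one to which [ge0_integral_rV_affine] applies. *)
  have -> : (fun y => (\1_E (x, y))%:E) = (fun y => ((jump lam x (1 *: y - x))%:R : R)%:E).
    by apply/funext => y; rewrite EE scale1r.
  rewrite iintE//; last exact: (measurableT_comp (mjx x) (measurable_affine_rV 1 (- x))).
  have := @ge0_integral_rV_affine R n.+1 1 (- x) (fun h => ((jump lam x h)%:R : R)%:E) ltr01 (mjx x) (jump_ge0 lam x).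
  by rewrite invr1 expr1n mul1e.
rewrite iintE//.
  exact: (@measurable_fun_param_integral _ _ _ _ _ muV _ (jump_ge0 lam) (mjump lam)).
by move=> x; apply: integral_ge0 => h _; exact: jump_ge0.
Qed.

Let measurable_line d (T : measurableType d) (u : T -> V) (s : T -> R) (m : V) :
  measurable_fun setT u -> measurable_fun setT s ->
  measurable_fun setT (fun z => u z + s z *: m).
Proof.
move=> mu' ms; apply: measurable_fun_rV => i.
under eq_fun do rewrite !mxE.
apply: measurable_funD; first exact: (measurableT_comp (measurable_coord i) mu').
exact: measurable_funM.
Qed.

Lemma directional_estimate (m : V) (c : R) : 0 < c ->
  (\int[mu]_s \int[muV]_x
     ((0 < s)%R%:R * s ^+ n * (c * s `^ al <= `|f (x + s *: m) - f x|)%R%:R)%:E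
   <= (10 * 2 ^+ n.+1 * c `^ (- p))%:E * \int[muV]_x (`|'D_m f x| `^ p)%:E)%E.
Proof.
move=> c0.
have [L L0 HL] := smooth_bounded fsm.
(* No jump occurs beyond [S]: for [s > 1] it would give [c s <= c s^al <= 2 L], because [al >= 1].
   The summand 1 covers [s <= 1]. *)
pose S := 1 + 2 * L / c.
have S0 : 0 < S by rewrite /S ltr_pwDl// divr_ge0 ?mulr_ge0 ?ltW.
have al1 : 1 <= al by rewrite lerDr divr_ge0// ltW.
pose b (x : V) (s : R) := [&& 0 < s, s <= S & c * s `^ al <= `|f (x + s *: m) - f x| ].
have bE x s : (0 < s)%R%:R * s ^+ n * (c * s `^ al <= `|f (x + s *: m) - f x|)%R%:R
    = (b x s)%:R * s ^+ n.
  rewrite /b; have [s0|s0] := ltrP 0 s; last by rewrite !mul0r.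
  rewrite mul1r mulrC; case: (leP (c * s `^ al)) => h; last by rewrite !andbF.
  rewrite andbT; suff -> : s <= S by [].
  have [s1|s1] := leP s 1; first by rewrite (le_trans s1)// lerDl divr_ge0 ?mulr_ge0 ?ltW.
  apply: (@le_trans _ _ (2 * L / c)); last by rewrite lerDr.
  rewrite ler_pdivlMr// mulrC (le_trans _ (le_trans h _))//.
    by rewrite ler_pM2l// -[leLHS]powRr1 ?(ltW s0)// ler_powR// ltW.
  rewrite (le_trans (ler_normB _ _))//; have := HL x; have := HL (x + s *: m); lra.
pose G (x : V) := (\int[mu]_s ((b x s)%:R * s ^+ n)%:E)%E.
have mb : measurable_fun setT (fun z : V * R => ((b z.1 z.2)%:R * z.2 ^+ n)%:E).
  have m1 : measurable_fun setT (fun z : V * R => z.1) by exact: measurable_fst.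
  have m2 : measurable_fun setT (fun z : V * R => z.2) by exact: measurable_snd.
  apply/measurable_EFinP; apply: measurable_funM; last exact: measurable_funX.
  apply: measurable_bool_natr.
  apply: measurable_and; first exact: measurable_fun_ltr.
  apply: measurable_and; first exact: measurable_fun_ler.
  apply: measurable_fun_ler.
    by apply: measurable_funM => //; exact: (measurableT_comp (measurable_powR _) m2).
  apply: measurableT_comp => //; apply: measurable_funB.
    by apply: (measurableT_comp mf); exact: measurable_line.
  exact: (measurableT_comp mf m1).
have b0 x s : (0 <= ((b x s)%:R * s ^+ n)%:E)%E.
  rewrite lee_fin; case E : (b x s); last by rewrite mul0r.
  by move/and3P: E => [s0 _ _]; rewrite mul1r exprn_ge0// ltW.
have mG : measurable_fun setT G.
  exact: (@measurable_fun_param_integral _ _ _ _ _ mu _ b0 mb).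
have G0 x : (0 <= G x)%E by apply: integral_ge0 => s _; exact: b0.
have -> : (\int[mu]_s \int[muV]_x
     ((0 < s)%R%:R * s ^+ n * (c * s `^ al <= `|f (x + s *: m) - f x|)%R%:R)%:E =
  \int[muV]_x G x)%E.
  rewrite /G [RHS](@tonelli_swap _ _ _ _ _ muV mu _ b0 mb).
  by apply: eq_integral => s _; apply: eq_integral => x _; rewrite bE.
pose D (x : V) : \bar R := (`|'D_m f x| `^ p)%:E.
have mD : measurable_fun setT D.
  apply/measurable_EFinP; apply: (measurableT_comp (measurable_powR _)).
  apply: measurableT_comp => //; apply: continuous_measurable_rV.
  exact: smooth_derive_continuous.
have D0 x : (0 <= D x)%E by rewrite lee_fin powR_ge0.
(* Averaging over the translates [x + t m] turns integrals over space into integrals over lines. *)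
have avg (T : R) (F : V -> \bar R) : 0 <= T -> measurable_fun setT F -> (forall x, 0 <= F x)%E ->
  (T%:E * \int[muV]_x F x = \int[muV]_x \int[mu]_(t in `[0%R, T]) F (x + t *: m)%R)%E.
  move=> T0 mF F0.
  pose H (x : V) (t : R) := ((t \in `[0, T])%:R%:E * F (x + t *: m)%R)%E.
  have H0 x t : (0 <= H x t)%E by rewrite mule_ge0// lee_fin.
  have mH : measurable_fun setT (fun z : V * R => H z.1 z.2).
    apply: emeasurable_funM.
      apply/measurable_EFinP; apply: measurable_bool_natr.
      under eq_fun do rewrite in_itv/=.
      by apply: measurable_and; exact: measurable_fun_ler.
    by apply: (measurableT_comp mF); exact: measurable_line.
  transitivity (\int[muV]_x \int[mu]_t H x t)%E; last first.
    apply: eq_integral => x _; rewrite [RHS]integral_mkcond; apply: eq_integral => t _.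
    by rewrite patchE mem_setE /H; case: ifPn => _; rewrite ?mul1e ?mul0e.
  rewrite [RHS](@tonelli_swap _ _ _ _ _ muV mu _ H0 mH).
  transitivity (\int[mu]_t ((t \in `[0%R, T])%:R%:E * \int[muV]_x F x))%E.
    rewrite ge0_integralZr//.
    - by rewrite integral_itv_natr// subr0.
    - apply/measurable_EFinP; apply: measurable_bool_natr.
      under eq_fun do rewrite in_itv/=.
      by apply: measurable_and; exact: measurable_fun_ler.
    - exact: integral_ge0.
  apply: eq_integral => t _; rewrite /H ge0_integralZl_EFin//.
    congr (_ * _)%E.
    have := @ge0_integral_rV_affine R n.+1 1 (t *: m) F ltr01 mF F0.
    rewrite invr1 expr1n mul1e => <-.
    by apply: eq_integral => x _; rewrite scale1r.
  by apply: (measurableT_comp mF); exact: measurable_line.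
have C0 : 0 <= 5 * 2 ^+ n.+1 * c `^ (- p).
  by rewrite mulr_ge0 ?powR_ge0// mulr_ge0// exprn_ge0.
have mDl : measurable_fun setT (fun z : V * R => D (z.1 + z.2 *: m)).
  by apply: (measurableT_comp mD); exact: measurable_line.
have mGl : measurable_fun setT (fun z : V * R => G (z.1 + z.2 *: m)).
  by apply: (measurableT_comp mG); exact: measurable_line.
have mint (T : R) (F : V -> \bar R) : (forall x, 0 <= F x)%E ->
    measurable_fun setT (fun z : V * R => F (z.1 + z.2 *: m)%R) ->
    measurable_fun setT (fun x : V => \int[mu]_(t in `[0%R, T]) F (x + t *: m)%R)%E.
  move=> F0 mF.
  under eq_fun do rewrite integral_mkcond.
  pose H (x : V) (t : R) := ((t \in `[0, T])%:R%:E * F (x + t *: m)%R)%E.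
  rewrite (_ : (fun x => _) = (fun x => \int[mu]_t H x t)%E); last first.
    apply/funext => x; apply: eq_integral => t _.
    by rewrite patchE mem_setE /H; case: ifPn => _; rewrite ?mul1e ?mul0e.
  apply: measurable_fun_param_integral => [x t|]; first by rewrite mule_ge0// lee_fin.
  apply: emeasurable_funM => //.
  apply/measurable_EFinP; apply: measurable_bool_natr.
  under eq_fun do rewrite in_itv/=.
  by apply: measurable_and; exact: measurable_fun_ler.
have line x : (\int[mu]_(t in `[0%R, S]) G (x + t *: m)%R <=
    (5 * 2 ^+ n.+1 * c `^ (- p))%:E * \int[mu]_(t in `[0%R, (2 * S)%R]) D (x + t *: m)%R)%E.
  have cD : continuous (fun t : R => 'D_m f (x + t *: m)).
    move=> t; have ct : (x + u *: m) @[u --> t] --> x + t *: m.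
      by apply: cvgD; [exact: cvg_cst|apply: cvgZl; exact: cvg_id].
    exact: (cvg_comp _ _ ct (smooth_derive_continuous fsm (v := m) (x := _))).
  have := @one_dim_estimate R n _ _ (smooth_is_derive_line fsm x m) cD p c S p1 c0 S0.
  move=> /(le_trans _); apply; rewrite le_eqVlt; apply/predU1P; left.
  rewrite integral_mkcond; apply: eq_integral => t _.
  rewrite patchE mem_setE in_itv/=; case: ifPn => [/andP[t1 t2]|].
    apply: eq_integral => s _; congr (_%:R * _)%:E.
    by rewrite /b t1 t2/= scalerDl addrA.
  move=> tS; rewrite integral0_eq// => s _.
  by rewrite andbA (negbTE tS) mul0r.
(* The left side is averaged over a window of length [S], the right side over one of length [2 S];
   the quotient turns 5 into 10. *)
rewrite -(@lee_pmul2l _ S%:E)// ?lte_fin// avg//; last exact: ltW.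
apply: (@le_trans _ _ (\int[muV]_x ((5 * 2 ^+ n.+1 * c `^ (- p))%:E *
    \int[mu]_(t in `[0%R, (2 * S)%R]) D (x + t *: m)%R))%E).
  apply: ge0_le_integral => //.
  - by move=> x _; apply: integral_ge0 => t _.
  - exact: mint.
  - by apply: measurable_funeM; exact: mint.
rewrite ge0_integralZl_EFin//; last 2 first.
- by move=> x _; apply: integral_ge0 => t _.
- exact: mint.
rewrite -avg// ?mulr_ge0 ?(ltW S0)// !muleA -!EFinM.
rewrite le_eqVlt; apply/orP; left; apply/eqP; congr (_%:E * _)%E; ring.
Qed.

(** In the direction [m] the slope constant is [c = lam * N m^al], so [c^(-p)] is
    [lam^(-p) * N m^(-(n.+1 + p))] and the weight of the polar formula cancels it. What remains is
    the integral of [|D_m f|^p] over all [x] and over [m] in [K]. *)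
Lemma level_set_upper (lam : R) : 0 < lam ->
  ((lam `^ p)%:E * \int[muV]_x \int[muV]_h ((jump lam x h)%:R : R)%:E
   <= (10 * 2 ^+ n.+1 * (n.+1%:R + p))%:E * energy)%E.
Proof.
move=> l0.
pose F (h : V) := (\int[muV]_x ((jump lam x h)%:R : R)%:E)%E.
have mjump' : measurable_fun setT (fun z : V * V => ((jump lam z.2 z.1)%:R : R)%:E).
  exact: (measurableT_comp (mjump lam) (@measurable_swap _ _ V V)).
have mF : measurable_fun setT F.
  by apply: (@measurable_fun_param_integral _ _ _ _ _ muV (fun h x => ((jump lam x h)%:R : R)%:E)) => // h x; exact: jump_ge0.
have F0 h : (0 <= F h)%E by apply: integral_ge0 => x _; exact: jump_ge0.
rewrite (@tonelli_swap _ _ _ _ _ muV muV _ (jump_ge0 lam) (mjump lam)).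
rewrite -[X in (_ * X)%E]/(\int[muV]_h F h)%E (integral_polar mN N_gt0 NZ np mF F0).
pose D (m : V) := (\int[muV]_x (`|'D_m f x| `^ p)%:E)%E.
have D0 m : (0 <= D m)%E by apply: integral_ge0 => x _; rewrite lee_fin powR_ge0.
have mDD : measurable_fun setT (fun z : V * V => (`|'D_(z.1) f z.2| `^ p)%:E).
  apply/measurable_EFinP; apply: (measurableT_comp (measurable_powR _)).
  apply: measurableT_comp => //.
  under eq_fun do rewrite (smooth_derive_dotp fsm).
  by apply: measurable_dotp => //; exact: (measurableT_comp (measurable_gradient fsm) measurable_snd).
have mD : measurable_fun setT D.
  apply: (@measurable_fun_param_integral _ _ _ _ _ muV (fun m x => (`|'D_m f x| `^ p)%:E)) => // m x.
have mball : measurable_fun setT (fun m : V => ((N m <= 1)%R%:R : R)).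
  by apply: measurable_bool_natr; exact: measurable_fun_ler.
pose c1 : R := 10 * 2 ^+ n.+1.
have c10 : 0 <= c1 by rewrite mulr_ge0// exprn_ge0.
(* Tonelli, with ['D_m f x] written as the product of [m] with the gradient: the directions [m] of
   the polar formula play the part of the variable [y] in the moment. *)
have energyE : (energy = \int[muV]_m ((N m <= 1)%R%:R%:E * D m))%E.
  pose G (x m : V) : \bar R := ((N m <= 1)%R%:R * `|dotp (gradient f x) m| `^ p)%:E.
  have G0 x m : (0 <= G x m)%E by rewrite lee_fin mulr_ge0// powR_ge0.
  have mG : measurable_fun setT (fun z : V * V => G z.1 z.2).
    apply/measurable_EFinP; apply: measurable_funM.
      exact: (measurableT_comp mball measurable_snd).
    apply: (measurableT_comp (measurable_powR _)); apply: measurableT_comp => //.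
    by apply: measurable_dotp => //; exact: (measurableT_comp (measurable_gradient fsm) measurable_fst).
  rewrite /energy [LHS](@tonelli_swap _ _ _ _ _ muV muV _ G0 mG).
  apply: eq_integral => m _.
  have mDm : measurable_fun setT (fun x : V => (`|'D_m f x| `^ p)%:E).
    exact: (measurableT_comp mDD (pair1_measurable m)).
  have Dm0 (x : V) : setT x -> (0 <= (`|'D_m f x| `^ p)%:E)%E by rewrite lee_fin powR_ge0.
  have := @ge0_integralZl_EFin _ _ R muV setT measurableT _ Dm0 mDm _ (ler0n R (N m <= 1)%R).
  rewrite -/(D m) => <-.
  by apply: eq_integral => x _; rewrite /G -EFinM -(smooth_derive_dotp fsm).
have key : (\int[muV]_m (((N m <= 1)%R%:R * N m `^ (n.+1%:R + p))%:E *
     \int[mu]_s (((0 < s)%R%:R * s ^+ n)%:E * F (s *: m)%R))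
   <= (c1 * lam `^ (- p))%:E * energy)%E.
  have cl0 : 0 <= c1 * lam `^ (- p) by rewrite mulr_ge0// powR_ge0.
  rewrite energyE -ge0_integralZl_EFin//; last 2 first.
  - by move=> m _; rewrite mule_ge0// lee_fin.
  - by apply: emeasurable_funM => //; exact/measurable_EFinP.
  have mFs : measurable_fun setT (fun z : V * R => (((0 < z.2)%R%:R * z.2 ^+ n)%:E * F (z.2 *: z.1)%R)%E).
    apply: emeasurable_funM.
      apply/measurable_EFinP; apply: measurable_funM.
        by apply: measurable_bool_natr; exact: measurable_fun_ltr.
      by apply: measurable_funX; exact: measurable_snd.
    apply: (measurableT_comp mF); exact: measurable_scale_rV.
  have Fs0 m s : (0 <= ((0 < s)%R%:R * s ^+ n)%:E * F (s *: m)%R)%E.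
    rewrite mule_ge0// lee_fin; have [s0|s0] := ltrP 0 s; last by rewrite mul0r.
    by rewrite mul1r exprn_ge0// ltW.
  have mw : measurable_fun setT (fun m => ((N m <= 1)%R%:R * N m `^ (n.+1%:R + p))).
    by apply: measurable_funM => //; exact: (measurableT_comp (measurable_powR _) mN).
  apply: ge0_le_integral => //.
  - move=> m _; rewrite mule_ge0// ?lee_fin ?mulr_ge0 ?powR_ge0//.
    by apply: integral_ge0 => s _; exact: Fs0.
  - apply: emeasurable_funM; first exact/measurable_EFinP.
    exact: (@measurable_fun_param_integral _ _ _ _ _ mu _ Fs0 mFs).
  - apply: measurable_funeM.
    by apply: emeasurable_funM => //; exact/measurable_EFinP.
  move=> m _; have [->|m0] := eqVneq m 0.
    rewrite (gauge0 Kbody Ksym) powR0 ?gt_eqF// mulr0 mul0e.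
    by rewrite mule_ge0// mule_ge0// lee_fin.
  have c0 : 0 < lam * N m `^ al by rewrite mulr_gt0// powR_gt0// N_gt0.
  have := directional_estimate m c0.
  set A := (\int[mu]_s \int[muV]_x _)%E.
  have -> : A = (\int[mu]_s (((0 < s)%R%:R * s ^+ n)%:E * F (s *: m)%R))%E.
    apply: eq_integral => s _; rewrite /F.
    have [s0|s0] := ltrP 0 s; last first.
      by rewrite !mul0r mul0e integral0_eq// => x _; rewrite mul0r.
    rewrite -ge0_integralZl_EFin//; last 2 first.
    - exact: (measurableT_comp mjump' (pair1_measurable (s *: m))).
    - by rewrite mul1r exprn_ge0// ltW.
    apply: eq_integral => x _; rewrite -EFinM /jump scaler_eq0 (gt_eqF s0) (negbTE m0)/=.
    rewrite NZ// (powRM _ (ltW s0) (N_ge0 m)).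
    by rewrite [s `^ _ * _]mulrC mulrA.
  have w0 : (0 <= ((N m <= 1)%R%:R * N m `^ (n.+1%:R + p))%:E)%E.
    by rewrite lee_fin mulr_ge0// powR_ge0.
  move=> /(lee_wpmul2l w0)/le_trans; apply; rewrite le_eqVlt; apply/predU1P; left.
  rewrite !muleA -!EFinM; congr (_%:E * _)%E.
  rewrite (powRM _ (ltW l0) (powR_ge0 _ _)) -(powRrM (N m)) -/c1.
  have -> : (N m <= 1)%R%:R * N m `^ (n.+1%:R + p) * (c1 * (lam `^ (- p) * N m `^ (al * - p)))
    = c1 * lam `^ (- p) * (N m <= 1)%R%:R * (N m `^ (n.+1%:R + p) * N m `^ (al * - p)) :> R.
    by move: (N m `^ _) (N m `^ _) (lam `^ _) ((N m <= 1)%R%:R) => u v w z; ring.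
  rewrite -powRD; last by rewrite (gt_eqF (N_gt0 m0)) implybT.
  rewrite (_ : n.+1%:R + p + _ = 0) ?powRr0 ?mulr1//.
  by rewrite mulrN mulrDl divfK ?(lt0r_neq0 p0)// mul1r subrr.
have l1 : (0 <= (lam `^ p * (n.+1%:R + p))%:E)%E.
  by rewrite lee_fin mulr_ge0 ?powR_ge0// ltW.
rewrite muleA -EFinM; apply: (le_trans (lee_wpmul2l l1 key)).
rewrite muleA -EFinM le_eqVlt; apply/predU1P; left; congr (_%:E * _)%E.
rewrite /c1 powRN; field; by rewrite gt_eqF// powR_gt0.
Qed.

End level_sets.

(** * The limit *)

Section level_set_limit.
Context {R : realType} (n : nat) (K : set 'rV[R]_n.+1) (p : R) (f : 'rV[R]_n.+1 -> R).
Hypothesis Kbody : convex_body K.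
Hypothesis Ksym : origin_symmetric K.
Hypothesis p1 : 1 <= p.
Hypothesis fsm : smooth_compact_support f.
Notation mu := (@lebesgue_measure R).
Notation N := (minkowski_functional K).
Notation V := 'rV[R]_n.+1.
Notation muV := (@rV_measure R n.+1).
Local Notation al := (n.+1%:R / p + 1).

Let p0 : 0 < p. Proof. by apply: lt_le_trans p1. Qed.
Let np : 0 < n.+1%:R + p. Proof. by rewrite addr_gt0. Qed.
Let mN := measurable_gauge Kbody Ksym.
Let N_ge0 := gauge_ge0 Kbody Ksym.
Let N_gt0 := gauge_gt0 Kbody Ksym.
Let NZ := gaugeZ Kbody Ksym.
Let mf : measurable_fun setT f := continuous_measurable_rV (smooth_continuous fsm).

Definition jump_rescaled (e : R) (x k : V) : bool :=
  (k != 0) && (e * N k `^ al <= `|f (x + e *: k) - f x|).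

Let scale (lam : R) : R := lam `^ (- (p / n.+1%:R)).

(** With [e = scale lam] one has [e^(n.+1 / p) = lam^-1], hence [lam * e^al = e]. *)
Lemma jump_scaleE (lam : R) x k : 0 < lam ->
  jump K p f lam x (scale lam *: k) = jump_rescaled (scale lam) x k.
Proof.
move=> l0; have s0 : 0 < scale lam by exact: powR_gt0.
have E : lam * N (scale lam *: k) `^ al = scale lam * N k `^ al.
  rewrite NZ// (powRM _ (ltW s0) (N_ge0 k)) mulrA; congr (_ * _).
  rewrite /scale -powRrM -{1}(powRr1 (ltW l0)) -powRD; last by rewrite (gt_eqF l0) implybT.
  congr (_ `^ _); field; by rewrite (gt_eqF p0) addrC natr1 pnatr_eq0.
by rewrite /jump /jump_rescaled E scaler_eq0 (gt_eqF s0).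
Qed.

Lemma measurable_jump_rescaled e :
  measurable_fun setT (fun z : V * V => jump_rescaled e z.1 z.2).
Proof.
have m1 : measurable_fun setT (fun z : V * V => z.1) by exact: measurable_fst.
have m2 : measurable_fun setT (fun z : V * V => z.2) by exact: measurable_snd.
apply: measurable_and; first exact: (measurableT_comp (@measurable_rV_eq0 R n.+1) m2).
apply: measurable_fun_ler.
  apply: measurable_funM => //.
  exact: (measurableT_comp (measurable_powR _) (measurableT_comp mN m2)).
apply: measurableT_comp => //; apply: measurable_funB.
  apply: (measurableT_comp mf); apply: measurable_fun_rV => i.
  under eq_fun do rewrite !mxE.
  apply: measurable_funD.
    exact: (measurableT_comp (measurable_coord i) m1).
  apply: measurable_funM => //; exact: (measurableT_comp (measurable_coord i) m2).
exact: (measurableT_comp mf m1).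
Qed.

Let mjr e : measurable_fun setT (fun z : V * V => ((jump_rescaled e z.1 z.2)%:R : R)%:E).
Proof. by apply/measurable_EFinP/measurable_bool_natr; exact: measurable_jump_rescaled. Qed.

Let jr_ge0 e x h : (0 <= ((jump_rescaled e x h)%:R : R)%:E)%E.
Proof. by rewrite lee_fin. Qed.

(** Only the increment is dilated; the Jacobian [(scale lam)^(-n.+1)] is exactly [lam^p]. The right
    side is over the product measure, where dominated convergence will be applied. *)
Lemma jump_rescale (lam : R) : 0 < lam ->
  ((lam `^ p)%:E * \int[muV]_x \int[muV]_h ((jump K p f lam x h)%:R : R)%:E
   = \int[(muV \x muV)%E]_z ((jump_rescaled (scale lam) z.1 z.2)%:R : R)%:E)%E.
Proof.
move=> l0; have s0 : 0 < scale lam by exact: powR_gt0.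
have mj : measurable_fun setT (fun z : V * V => ((jump K p f lam z.1 z.2)%:R : R)%:E).
  apply/measurable_EFinP/measurable_bool_natr.
  exact: (measurable_jump p Kbody Ksym fsm lam).
have j0 x h : (0 <= ((jump K p f lam x h)%:R : R)%:E)%E by rewrite lee_fin.
rewrite (@fubini_tonelli1 _ _ _ _ _ muV muV _ (mjr (scale lam)))//.
rewrite -(@ge0_integralZl_EFin _ _ _ muV setT measurableT _ _ _ (lam `^ p) (powR_ge0 _ _)); last 2 first.
- by move=> x _; apply: integral_ge0 => h _.
- exact: (@measurable_fun_param_integral _ _ _ _ _ muV _ j0 mj).
apply: eq_integral => x _; rewrite /fubini_F/=.
have mjx : measurable_fun setT (fun h => ((jump K p f lam x h)%:R : R)%:E).
  exact: (measurableT_comp mj (pair1_measurable x)).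
have := @ge0_integral_rV_affine R n.+1 (scale lam) 0 _ s0 mjx (j0 x).
have -> : (scale lam)^-1 ^+ n.+1 = lam `^ p.
  rewrite /scale -powRN opprK -powR_mulrn ?powR_ge0// -powRrM divfK// pnatr_eq0.
by move=> <-; apply: eq_integral => k _; rewrite addr0 jump_scaleE.
Qed.

Definition jump_limit (x k : V) : bool :=
  (k != 0) && (N k `^ al <= `|dotp (gradient f x) k|).

(** The difference quotients tend to the derivative along [k]. Off the equality case the limiting
    comparison is strict, so the truth value is eventually constant. *)
Lemma jump_rescaled_cvg (e : R^nat) x k : (forall i, 0 < e i) -> e i @[i --> \oo] --> 0 ->
  N k `^ al != `|dotp (gradient f x) k| ->
  ((jump_rescaled (e i) x k)%:R : R)%:E @[i --> \oo] --> ((jump_limit x k)%:R : R)%:E.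
Proof.
move=> e0 ecvg tie; apply: cvg_near_cst.
rewrite /jump_rescaled /jump_limit; have [->|k0] := eqVneq k 0; first exact: nearW.
rewrite /=.
pose q i := (e i)^-1 * (f (x + e i *: k) - f x).
have qE i : (e i * N k `^ al <= `|f (x + e i *: k) - f x|) = (N k `^ al <= `|q i|).
  by rewrite /q normrM gtr0_norm ?invr_gt0// ler_pdivlMl.
have qcvg : `|q i| @[i --> \oo] --> `|dotp (gradient f x) k|.
  apply: cvg_norm; rewrite -(smooth_derive_dotp fsm).
  have D : derivable f x k by exact: smooth_derivable.
  have /cvg_at_rightP/(_ e (conj e0 ecvg)) := cvg_dnbhs_at_right D.
  by rewrite /q; under eq_fun do rewrite /= [_ + x]addrC.
case: ltgtP tie => // h _.
  near=> i; rewrite qE ltW//; near: i.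
  by have := cvgr_gt _ qcvg; apply.
near=> i; rewrite qE leNgt (_ : `|q i| < _)//; near: i.
by have := cvgr_lt _ qcvg; apply.
Unshelve. all: by end_near. Qed.

(** For [k]: the Lipschitz bound gives [e * N k^al <= L * e * |k| <= L * e * M * N k], and dividing
    by [e * N k] bounds [N k]. For [x]: if [x] is far away, then so is [x + e k] because [e <= 1],
    and [f] vanishes at both points although a jump must be positive. *)
Lemma jump_rescaled_bounded : exists M : R, forall e x k, 0 < e <= 1 ->
  jump_rescaled e x k -> `|x| <= M /\ `|k| <= M.
Proof.
have [L L0 HL] := smooth_lipschitz fsm.
have [M M0 HM] := norm_le_gauge Kbody Ksym.
have [S S0 HS] := smooth_support fsm.
pose r := n.+1%:R / p; have r0 : 0 < r by rewrite divr_gt0.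
pose rho := (L * M) `^ r^-1.
have rho0 : 0 <= rho by exact: powR_ge0.
exists (S + M * rho) => e x k /andP[e0 e1] /andP[k0 h].
have kM : `|k| <= M * rho.
  rewrite (le_trans (HM k))// ler_wpM2l ?(ltW M0)//.
  have h1 : N k `^ r <= L * M.
    rewrite -(ler_pM2r (N_gt0 k0)) -(ler_pM2l e0).
    have -> : N k `^ r * N k = N k `^ al.
      by rewrite powRD ?powRr1// (gt_eqF (N_gt0 k0)) implybT.
    rewrite (le_trans h)// (le_trans (HL _ _))// normrZ (gtr0_norm e0) mulrCA.
    by rewrite ler_wpM2l ?(ltW e0)// -mulrA ler_wpM2l ?(ltW L0).
  rewrite -[leLHS](powRr1 (N_ge0 k)) -(mulfV (lt0r_neq0 r0)) (powRrM (N k) r).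
  apply: ge0_ler_powR => //; rewrite ?nnegrE ?powR_ge0//; first by rewrite invr_ge0 ltW.
  by rewrite mulr_ge0// ltW.
split; last by rewrite (le_trans kM)// lerDr ltW.
rewrite leNgt; apply/negP => xS.
move: h; rewrite (HS x); last by rewrite (le_lt_trans _ xS)// lerDl mulr_ge0// ltW.
rewrite (HS (x + e *: k)); last first.
  rewrite -ltrBDr in xS; apply: (lt_le_trans xS).
  have ek : `|e *: k| <= M * rho.
    by rewrite normrZ (gtr0_norm e0) (le_trans _ kM)// ger_pMl// normr_gt0.
  rewrite lerBlDr; apply: (le_trans _ (lerD (lexx _) ek)).
  by rewrite -{1}(addrK (e *: k) x) ler_normB.
by rewrite subrr normr0 leNgt mulr_gt0// powR_gt0// N_gt0.
Qed.

Lemma measurable_jump_limit : measurable_fun setT (fun z : V * V => jump_limit z.1 z.2).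
Proof.
have m1 : measurable_fun setT (fun z : V * V => z.1) by exact: measurable_fst.
have m2 : measurable_fun setT (fun z : V * V => z.2) by exact: measurable_snd.
apply: measurable_and; first exact: (measurableT_comp (@measurable_rV_eq0 R n.+1) m2).
apply: measurable_fun_ler.
  exact: (measurableT_comp (measurable_powR _) (measurableT_comp mN m2)).
apply: measurableT_comp => //; apply: measurable_dotp => //.
exact: (measurableT_comp (measurable_gradient fsm) m1).
Qed.

Lemma integral_jump_limit :
  (\int[(muV \x muV)%E]_z ((jump_limit z.1 z.2)%:R : R)%:E
   = ((n.+1%:R + p) / n.+1%:R)%:E * energy K p f)%E.
Proof.
have ml : measurable_fun setT (fun z : V * V => ((jump_limit z.1 z.2)%:R : R)%:E).
  by apply/measurable_EFinP/measurable_bool_natr; exact: measurable_jump_limit.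
rewrite (@fubini_tonelli1 _ _ _ _ _ muV muV _ ml)//.
have c0 : 0 <= (n.+1%:R + p) / n.+1%:R by rewrite divr_ge0// ltW.
have mm : measurable_fun setT (fun x => moment K p (gradient f x)).
  exact: (measurableT_comp (measurable_moment p Kbody Ksym) (measurable_gradient fsm)).
have m0 x : setT x -> (0 <= moment K p (gradient f x))%E by move=> _; exact: moment_ge0.
rewrite /energy -(@ge0_integralZl_EFin _ _ _ muV setT measurableT _ m0 mm _ c0).
by apply: eq_integral => x _; rewrite -(volume_moment Kbody Ksym p1).
Qed.

Lemma tie_negligible :
  (muV \x muV)%E [set z : V * V | (z.2 != 0) && (N z.2 `^ al == `|dotp (gradient f z.1) z.2|)] = 0%E.
Proof.
have m1 : measurable_fun setT (fun z : V * V => z.1) by exact: measurable_fst.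
have m2 : measurable_fun setT (fun z : V * V => z.2) by exact: measurable_snd.
pose t (x k : V) := (k != 0) && (N k `^ al == `|dotp (gradient f x) k|).
have mt : measurable_fun setT (fun z : V * V => t z.1 z.2).
  apply: measurable_and; first exact: (measurableT_comp (@measurable_rV_eq0 R n.+1) m2).
  apply: measurable_fun_eqr.
    exact: (measurableT_comp (measurable_powR _) (measurableT_comp mN m2)).
  apply: measurableT_comp => //; apply: measurable_dotp => //.
  exact: (measurableT_comp (measurable_gradient fsm) m1).
rewrite -[X in (muV \x muV)%E X]setIT -integral_indic//; last exact: measurable_set_bool.
transitivity (\int[(muV \x muV)%E]_z ((t z.1 z.2)%:R : R)%:E)%E.
  apply: eq_integral => z _; rewrite indicE; congr ((nat_of_bool _)%:R%:E).
  by apply/idP/idP => [/set_mem//|?]; apply/mem_set.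
rewrite fubini_tonelli1//; last exact/measurable_EFinP/measurable_bool_natr.
by apply: integral0_eq => x _; exact: (tie_null Kbody Ksym p1 (gradient f x)).
Qed.

Lemma level_set_limit :
  ((lam `^ p)%:E * \int[muV]_x \int[muV]_h ((jump K p f lam x h)%:R : R)%:E)%E
    @[lam --> +oo] --> (((n.+1%:R + p) / n.+1%:R)%:E * energy K p f)%E.
Proof.
apply/cvge_pinftyP => u uoo.
(* The limit is taken along an arbitrary sequence [u], as dominated convergence is stated for
   sequences. The truncations give [0 < e i <= 1] for every [i], which the domination requires;
   eventually [e i] is [scale (u i)]. *)
pose e (i : nat) : R := Num.min (scale (Num.max 1 (u i))) 1.
have m0 i : 0 < Num.max 1 (u i) by rewrite lt_max ltr01.
have e01 i : 0 < e i <= 1 by rewrite lt_min ltr01 powR_gt0//= ge_min lexx orbT.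
have e0 i : 0 < e i by case/andP: (e01 i).
have u1 : \forall i \near \oo, 1 <= u i.
  by move/cvgryPge : uoo; apply.
have eE : \forall i \near \oo, e i = scale (u i).
  near=> i; have ui : 1 <= u i by near: i.
  rewrite /e max_r// min_l// /scale -[leRHS](powRr0 (u i)) ler_powR//.
  by rewrite oppr_le0 divr_ge0// ltW.
have ecvg : e i @[i --> \oo] --> 0.
  have s0 : scale (u i) @[i --> \oo] --> 0.
    have a0 : 0 < p / n.+1%:R by rewrite divr_gt0.
    rewrite /scale; under eq_fun do rewrite powRN.
    apply/(gtr0_cvgV0 (f := fun i => u i `^ (p / n.+1%:R))).
      near=> i; rewrite powR_gt0// (lt_le_trans ltr01)//; near: i; exact: u1.
    exact: (cvg_comp _ _ uoo (powR_cvgy a0)).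
  apply: cvg_trans s0; by apply: near_eq_cvg; apply: filterS eE => i ->.
pose F (i : nat) (z : V * V) : \bar R := ((jump_rescaled (e i) z.1 z.2)%:R : R)%:E.
rewrite -integral_jump_limit.
have [M HM] := jump_rescaled_bounded.
pose B := [set v : V | forall i, `|v ord0 i| <= M].
have mB : measurable B by exact: measurable_box.
have mBB : measurable (B `*` B) by exact: measurableX.
have mF i : measurable_fun setT (F i) by exact: mjr.
have mL : measurable_fun setT (fun z : V * V => ((jump_limit z.1 z.2)%:R : R)%:E).
  by apply/measurable_EFinP/measurable_bool_natr; exact: measurable_jump_limit.
pose T : set (V * V) := [set z | (z.2 != 0) && (N z.2 `^ al == `|dotp (gradient f z.1) z.2|)].
have mT : measurable T.
  have m1 : measurable_fun setT (fun z : V * V => z.1) by exact: measurable_fst.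
  have m2 : measurable_fun setT (fun z : V * V => z.2) by exact: measurable_snd.
  apply: measurable_set_bool; apply: measurable_and.
    exact: (measurableT_comp (@measurable_rV_eq0 R n.+1) m2).
  apply: measurable_fun_eqr.
    exact: (measurableT_comp (measurable_powR _) (measurableT_comp mN m2)).
  apply: measurableT_comp => //; apply: measurable_dotp => //.
  exact: (measurableT_comp (measurable_gradient fsm) m1).
have Fcvg : {ae (muV \x muV)%E, forall z, setT z ->
    F ^~ z @ \oo --> ((jump_limit z.1 z.2)%:R : R)%:E}.
  (* Outside [T] either [k = 0], where all the truth values are false, or the comparison is not an
     equality. *)
  exists T; split; [exact: mT|exact: tie_negligible|].
  move=> [x k] /= h; apply: contrapT => zT; apply: h => _.
  have [->|k0] := eqVneq k 0.
    apply: cvg_near_cst; apply: nearW => i.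
    by rewrite /F /jump_rescaled /jump_limit/= eqxx.
  apply: jump_rescaled_cvg => //; apply/negP => tie; apply: zT.
  by rewrite /T/= k0.
(* The common bounded set of [jump_rescaled_bounded] lies in the box [B * B], of finite measure; its
   indicator is the dominating function. *)
have gint : (muV \x muV)%E.-integrable setT (fun z => (\1_(B `*` B) z)%:E).
  apply/integrableP; split; first exact/measurable_EFinP/measurable_indic.
  rewrite (eq_integral (fun z => (\1_(B `*` B) z)%:E)); last first.
    by move=> z _; rewrite gee0_abs// lee_fin.
  rewrite integral_indic// setIT [X in (X < _)%E](product_measure1E muV muV mB mB).
  rewrite lte_mul_pinfty//; last exact: rV_measure_box.
  by rewrite ge0_fin_numE//; exact: rV_measure_box.
have Fdom : {ae (muV \x muV)%E, forall z i, setT z -> (`|F i z| <= (\1_(B `*` B) z)%:E)%E}.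
  apply: aeW => -[x k] i _; rewrite gee0_abs ?lee_fin//.
  rewrite indicE /=; case E : (jump_rescaled (e i) x k) => //.
  have [xM kM] := HM _ _ _ (e01 i) E.
  by rewrite mem_set//; split => j /=; rewrite (le_trans (rV_coord_le_norm _ _)).
have [_ _] := @dominated_convergence _ _ R (muV \x muV)%E setT measurableT F
  (fun z => ((jump_limit z.1 z.2)%:R : R)%:E) (fun z => (\1_(B `*` B) z)%:E)
  mF mL Fcvg gint Fdom.
apply: cvg_trans; apply: near_eq_cvg; near=> i.
have ui : 1 <= u i by near: i.
rewrite jump_rescale ?(lt_le_trans ltr01)//.
rewrite /= /F (_ : e i = scale (u i))//; near: i; exact: eE.
Unshelve. all: by end_near. Qed.

End level_set_limit.

Theorem theorem1p1 (R : realType) (n : nat) : (1 <= n)%N ->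
  exists C : R, 0 < C /\
  forall (p : R) (K : set 'rV[R]_n) (f : 'rV[R]_n -> R),
    1 <= p -> convex_body K -> origin_symmetric K -> smooth_compact_support f ->
    let I := iint (fun x => (normZpK p K (gradient f x) `^ p)%:E) in
    let g := fun x y => (f x - f y) / minkowski_functional K (x - y) `^ (n%:R / p + 1) in
    let D := [set xy : 'rV[R]_n * 'rV[R]_n | xy.1 <> xy.2] in
    ((2 / n%:R)%:E * I <= weakLp_pow p D g)%E /\
    (weakLp_pow p D g <= C%:E * I)%E /\
    ((lam `^ p)%:E * leb2n [set xy | D xy /\ (lam <= `|g xy.1 xy.2|)%R])%E
      @[lam --> +oo] --> ((2 / n%:R)%:E * I)%E.
Proof.
(* The factor 20 is 5 from the Vitali enlargement, 2 from the averaging windows, and 2 from the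
   normalisation [(n.+1 + p) / 2]. The power of 2 comes from lengths being controlled only up to
   doubling in the covering. *)
case: n => // n _; exists (20 * 2 ^+ n.+1); split; first by rewrite mulr_gt0 ?exprn_gt0.
move=> p K f p1 Kbody Ksym fsm I g D.
have p0 : 0 < p by apply: lt_le_trans p1.
have IE : I = (((n.+1%:R + p) / 2)%:E * energy K p f)%E by exact: iint_normZpK.
pose J (lam : R) := (\int[rV_measure n.+1]_x \int[rV_measure n.+1]_h
  ((jump K p f lam x h)%:R : R)%:E)%E.
have levelE lam : 0 < lam ->
    leb2n [set xy | D xy /\ (lam <= `|g xy.1 xy.2|)%R] = J lam.
  by move=> l0; exact: leb2n_jump.
have lim : ((lam `^ p)%:E * leb2n [set xy | D xy /\ (lam <= `|g xy.1 xy.2|)%R])%E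
      @[lam --> +oo] --> ((2 / n.+1%:R)%:E * I)%E.
  have -> : ((2 / n.+1%:R)%:E * I = ((n.+1%:R + p) / n.+1%:R)%:E * energy K p f)%E.
    rewrite IE muleA -EFinM; congr (_%:E * _)%E; field.
    by rewrite addrC natr1 pnatr_eq0.
  apply: cvg_trans (level_set_limit Kbody Ksym p1 fsm); apply: near_eq_cvg.
  near=> lam; rewrite levelE//; near: lam; apply: nbhs_pinfty_gt; exact: num_real.
split; last split => //.
  apply: (cvge_le _ lim); near=> lam.
  have l0 : 0 < lam by near: lam; apply: nbhs_pinfty_gt; exact: num_real.
  by apply: ereal_sup_ubound; exists lam.
apply: ge_ereal_sup => _ [lam /= l0 <-]; rewrite levelE//.
apply: (le_trans (level_set_upper Kbody Ksym p1 fsm l0)).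
rewrite IE muleA -EFinM le_eqVlt; apply/predU1P; left; congr (_%:E * _)%E.
by move: (2 ^+ n.+1) => u; field.
Unshelve. all: by end_near. Qed.
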